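(* Let $(M,g)$ be a space-time with Ricci tensor $Ric$ (local components $R_{ij}=Ric(\partial_i,\partial_j)$) and scalar curvature $s$, and let $T=Ric-\tfrac12 s\,g$ be the energy-momentum tensor given by the Einstein equations. Then the Einstein equations belong to the class $\Omega_1$, i.e. $\nabla_kT_{ij}+\nabla_iT_{jk}+\nabla_jT_{ki}=0$, if and only if the geodesic equations of $(M,g)$ admit the first quadratic integral $R_{ij}\frac{dx^i}{ds}\frac{dx^j}{ds}=\mathrm{const}$.
   Context: A space-time $(M,g)$ is a smooth four-dimensional manifold $M$ with a metric $g$ of Lorentz signature $(-+++)$; $\nabla$ is its Levi-Civita connection. The curvature tensor is given by $R^k_{lij}X^l=\nabla_i\nabla_jX^k-\nabla_j\nabla_iX^k$, the Ricci tensor by $R_{ij}=R^k_{ikj}$, and the scalar curvature by $s=g^{ij}R_{ij}$. The Einstein equations are $R_{ij}-\tfrac12 s\,g_{ij}=T_{ij}$; in particular $g^{ik}\nabla_iT_{kj}=0$. The Einstein equations belong to the class $\Omega_1$ if $\nabla_kT_{ij}+\nabla_iT_{jk}+\nabla_jT_{ki}=0$ everywhere on $M$. For a symmetric 2-tensor field $a$ with local components $a_{ij}$, the geodesic equations of $(M,g)$ are said to admit the first quadratic integral $a_{ij}\frac{dx^i}{ds}\frac{dx^j}{ds}=\mathrm{const}$ if for every (affinely parametrized) solution $x^k=x^k(s)$ of the geodesic equations the function $a_{ij}\frac{dx^i}{ds}\frac{dx^j}{ds}$ is constant along that solution (here $s$ denotes the parameter of the geodesic, not the scalar curvature). *)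

(* Defs.v *)
From HB Require Import structures.
From mathcomp Require Import all_boot all_order all_algebra.
From mathcomp Require Import all_classical all_reals all_analysis.

Set Implicit Arguments.
Unset Strict Implicit.
Unset Printing Implicit Defensive.

Import Order.TTheory GRing.Theory Num.Theory.
Import numFieldNormedType.Exports.

Local Open Scope classical_set_scope.
Local Open Scope ring_scope.

Section Calculus.
Context {R : realType} {n : nat}.
Implicit Types (f : 'rV[R]_n -> R) (D : set 'rV[R]_n).

Definition partial (i : 'I_n) f (x : 'rV[R]_n) : R := 'D_(delta_mx 0 i) f x.

(* C^oo on D, meant for open D: all iterated partial derivatives exist and are
   continuous at every point of D. *)
Definition smooth_on D f : Prop :=
  forall (s : seq 'I_n) x, D x ->
    {for x, continuous (foldr partial f s)} /\
    forall i, derivable (foldr partial f s) x (delta_mx 0 i).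

End Calculus.

Section Manifolds.
Context {R : realType} {n : nat} {M : topologicalType}.

(* The values of [coord] outside [dom] and of [param] outside the image of
   [dom] are irrelevant. *)
Record chart : Type := Chart {
  dom : set M;
  coord : M -> 'rV[R]_n;
  param : 'rV[R]_n -> M;
  dom_open : open dom;
  img_open : open (coord @` dom);
  coordK : forall p, dom p -> param (coord p) = p;
  coord_cts : forall p, dom p -> {for p, continuous coord};
  param_cts : forall x, (coord @` dom) x -> {for x, continuous param} }.

Definition chart_img (c : chart) : set 'rV[R]_n := coord c @` dom c.
Definition overlap (c d : chart) : set 'rV[R]_n := coord c @` (dom c `&` dom d).
Definition transition (c d : chart) : 'rV[R]_n -> 'rV[R]_n :=
  coord d \o param c.

Record is_smooth_atlas (A : set chart) : Prop := IsSmoothAtlas {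
  atlas_cover : forall p, exists2 c, A c & dom c p;
  atlas_compat : forall c d, A c -> A d ->
    forall k, smooth_on (overlap c d) (fun x => transition c d x 0 k) }.

(* A smooth structure is given by a (not necessarily maximal) smooth atlas. *)
Record is_smooth_manifold (A : set chart) : Prop := IsSmoothManifold {
  manifold_hausdorff : hausdorff_space M;
  manifold_second_countable : @second_countable M;
  manifold_atlas : is_smooth_atlas A }.

(* Local components a_ij of a covariant 2-tensor field in each chart, as
   functions of the coordinates; only the values on [chart_img c], for c in
   the atlas, are relevant. *)
Definition components2 : Type := chart -> 'rV[R]_n -> 'M[R]_n.

(* Row i, column k: the partial derivative of the k-th new coordinate with
   respect to the i-th old one. *)
Definition transition_jac (c d : chart) (x : 'rV[R]_n) : 'M[R]_n :=
  \matrix_(i, k) partial i (fun y => transition c d y 0 k) x.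

Record is_sym_tensor2 (A : set chart) (a : components2) : Prop := IsSymTensor2 {
  tensor2_smooth : forall c, A c ->
    forall i j, smooth_on (chart_img c) (fun x => a c x i j);
  tensor2_sym : forall c, A c -> forall x, chart_img c x -> (a c x)^T = a c x;
  tensor2_change : forall c d, A c -> A d -> forall x, overlap c d x ->
    a c x = transition_jac c d x *m a d (transition c d x)
              *m (transition_jac c d x)^T }.

End Manifolds.
Arguments chart : clear implicits.
Arguments components2 : clear implicits.

Section LocalGeometry.
Context {R : realType} {n : nat}.
Local Notation V := 'rV[R]_n.
Implicit Types (g : V -> 'M[R]_n) (i j k l m : 'I_n) (x : V).

Definition christoffel g k i j x : R :=
  2^-1 * \sum_l invmx (g x) k l *
    (partial i (fun y => g y j l) x + partial j (fun y => g y i l) x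
     - partial l (fun y => g y i j) x).

(* nabla_j X^k *)
Definition nabla_vect g (X : 'I_n -> V -> R) j k x : R :=
  partial j (X k) x + \sum_m christoffel g k j m x * X m x.

(* nabla_i nabla_j X^k: the covariant derivative of the mixed tensor
   nabla_j X^k, hence one correction term for each of its two indices. *)
Definition nabla2_vect g (X : 'I_n -> V -> R) i j k x : R :=
  partial i (nabla_vect g X j k) x
  + \sum_m christoffel g k i m x * nabla_vect g X j m x
  - \sum_m christoffel g m i j x * nabla_vect g X m k x.

Definition coord_vect l : 'I_n -> V -> R := fun k _ => (k == l)%:R.

(* R^k_{lij} with the convention
   R^k_{lij} X^l = nabla_i nabla_j X^k - nabla_j nabla_i X^k,
   read off at the coordinate field X = d/dx^l. *)
Definition riemann g k l i j x : R :=
  nabla2_vect g (coord_vect l) i j k x - nabla2_vect g (coord_vect l) j i k x.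

Definition ricci_loc g x : 'M[R]_n :=
  \matrix_(i, j) \sum_k riemann g k i k j x.

Definition scalar_loc g x : R :=
  \sum_i \sum_j invmx (g x) i j * ricci_loc g x i j.

(* nabla_k a_ij *)
Definition nabla_cov2 g (a : V -> 'M[R]_n) k i j x : R :=
  partial k (fun y => a y i j) x
  - \sum_m christoffel g m k i x * a x m j
  - \sum_m christoffel g m k j x * a x i m.

End LocalGeometry.

Section SpaceTime.
Context {R : realType} {M : topologicalType}.
Local Notation chart := (chart R 4 M).
Local Notation components2 := (components2 R 4 M).

Definition minkowski : 'M[R]_4 :=
  diag_mx (\row_i (if i == 0 then - 1 else 1)).

(* Signature (-+++): in a suitable basis (the rows of the inverse of P) the
   Gram matrix of G is diag(-1, 1, 1, 1). *)
Definition lorentz_signature (G : 'M[R]_4) : Prop :=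
  exists2 P : 'M[R]_4, P \in unitmx & G = P *m minkowski *m P^T.

Record is_spacetime (A : set chart) (g : components2) : Prop := IsSpacetime {
  spacetime_manifold : is_smooth_manifold A;
  spacetime_tensor : is_sym_tensor2 A g;
  spacetime_lorentz : forall c, A c -> forall x, chart_img c x ->
    lorentz_signature (g c x) }.

Definition ricci (g : components2) : components2 :=
  fun c x => ricci_loc (g c) x.

Definition energy_momentum (g : components2) : components2 :=
  fun c x => ricci g c x - (2^-1 * scalar_loc (g c) x) *: g c x.

Definition class_Omega1 (A : set chart) (g T : components2) : Prop :=
  forall c, A c -> forall x, chart_img c x -> forall i j k,
    nabla_cov2 (g c) (T c) k i j x + nabla_cov2 (g c) (T c) i j k x
    + nabla_cov2 (g c) (T c) j k i x = 0.

Definition coord_curve (c : chart) (gamma : R -> M) (k : 'I_4) : R -> R :=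
  fun t => coord c (gamma t) 0 k.

Definition velocity (c : chart) (gamma : R -> M) (k : 'I_4) : R -> R :=
  derive1 (coord_curve c gamma k).

(* [gamma] restricted to the open interval [I] solves the geodesic equations
   x''^k + Gamma^k_ij x'^i x'^j = 0 in every chart it meets. *)
Record is_geodesic (A : set chart) (g : components2) (I : set R)
    (gamma : R -> M) : Prop := IsGeodesic {
  geodesic_cts : forall t, I t -> {for t, continuous gamma};
  geodesic_eq : forall t, I t -> forall c, A c -> dom c (gamma t) ->
    forall k, [/\ derivable (coord_curve c gamma k) t 1,
        derivable (velocity c gamma k) t 1 &
        derive1 (velocity c gamma k) t
        + \sum_i \sum_j christoffel (g c) k i j (coord c (gamma t))
            * velocity c gamma i t * velocity c gamma j t = 0] }.

(* The value of a_ij dx^i/ds dx^j/ds at the parameter t may be computed in any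
   chart of the atlas around gamma t. *)
Definition first_quadratic_integral (A : set chart) (g a : components2) : Prop :=
  forall (I : set R) (gamma : R -> M),
    open I -> is_interval I -> is_geodesic A g I gamma ->
    exists C : R, forall t, I t -> forall c, A c -> dom c (gamma t) ->
      \sum_i \sum_j a c (coord c (gamma t)) i j
        * velocity c gamma i t * velocity c gamma j t = C.

End SpaceTime.

(* Main.v *)
(** Along a geodesic, the derivative of [R_ij x'^i x'^j] is the cubic form
    [nabla_k R_ij x'^k x'^i x'^j]; since every initial position and velocity is attained by
    a geodesic (Picard-Lindelof), the integral is first if and only if the cyclic sum of
    [nabla_k R_ij] vanishes. The contracted Bianchi identity [2 nabla^i R_ij = d_j s] makes
    this equivalent to the class Omega_1: contracting the cyclic sum of [nabla_k R_ij] with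
    [g^ij] gives [2 d_k s], and contracting that of [nabla_k T_ij] gives [- d_k s], so in both
    cases [s] is locally constant and the two cyclic sums coincide.

    A geodesic may leave a chart, so the value of [R_ij x'^i x'^j] must not depend on the
    chart. The Christoffel matrices transform as a gauge field, because the transformed ones
    are again torsion free and metric and such a connection is unique; the curvature and
    Ricci tensors then transform tensorially. *)

From HB Require Import structures.
Require Import Defs.
From mathcomp Require Import all_boot all_order all_algebra.
From mathcomp Require Import all_classical all_reals all_analysis.
From mathcomp Require Import ring lra.

Set Implicit Arguments.
Unset Strict Implicit.
Unset Printing Implicit Defensive.

Import Order.TTheory GRing.Theory Num.Theory.
Import numFieldNormedType.Exports.

Local Open Scope classical_set_scope.
Local Open Scope ring_scope.

(** * Functions of several real variables *)

(** Smoothness is given only through iterated partial derivatives, so the chain rule and the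
    symmetry of mixed derivatives are derived from the one-dimensional mean value theorem. Index
    computations are carried by matrices: the Bianchi identities, metric compatibility and the gauge
    law become identities in a noncommutative algebra with transposition, kept apart from the
    calculus. The dimension enters through one coefficient: contracting the cyclic sum of nabla_k
    R_ij - c d_k s g_ij gives (2 - (n + 2) c) d_k s, which for n = 4 is 2 at c = 0 and -1 at c =
    1/2. A geodesic has to satisfy its equation in every chart it meets, whereas the existence
    theorem yields a solution in one chart. The gauge law therefore serves twice: for the curvature,
    and to carry that solution to the other charts. A vanishing cubic form gives a vanishing cyclic
    sum by polarization; this uses the symmetry of Ric, which follows from the first Bianchi
    identity and the vanishing trace of the curvature matrices. *)

Section Norm.
Context {R : realType}.

Lemma entry_le_norm m n (x : 'M[R]_(m, n)) i j : `|x i j| <= `|x|.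
Proof.
rewrite [leRHS]/Num.Def.normr/= mx_normrE.
exact: (le_bigmax _ (fun p => `|x p.1 p.2|) (i, j)).
Qed.

Lemma norm_le_entry m n (x : 'M[R]_(m, n)) e :
  0 <= e -> (forall i j, `|x i j| <= e) -> `|x| <= e.
Proof.
by move=> e0 xe; rewrite [leLHS]/Num.Def.normr/= mx_normrE; apply: bigmax_le.
Qed.

Lemma norm_delta n (i : 'I_n) : `|delta_mx 0 i : 'rV[R]_n| = 1.
Proof.
apply/eqP; rewrite eq_le; apply/andP; split.
  apply: norm_le_entry => // k l; rewrite mxE.
  by case: (_ && _); rewrite ?normr1 ?normr0.
by have := entry_le_norm (delta_mx 0 i : 'rV[R]_n) 0 i; rewrite mxE !eqxx normr1.
Qed.

Lemma cvg_entries T (F : set_system T) {FF : Filter F} m n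
    (X : T -> 'M[R]_(m, n)) (l : 'M[R]_(m, n)) :
  (forall i j, (X t i j) @[t --> F] --> l i j) -> X @ F --> l.
Proof.
move=> Xl; apply/cvgrPdist_le => e e0.
have : \forall t \near F, forall p : 'I_m * 'I_n, `|l p.1 p.2 - X t p.1 p.2| <= e.
  by apply: filter_forall => p; move/cvgrPdist_le : (Xl p.1 p.2); exact.
apply: filterS => t Ht; apply: norm_le_entry (ltW e0) _ => i j.
by rewrite !mxE; exact: (Ht (i, j)).
Qed.

Lemma cvg_sumr T (F : set_system T) {FF : Filter F} (I : finType)
    (f : I -> T -> R) (l : I -> R) :
  (forall i, f i t @[t --> F] --> l i) ->
  (\sum_i f i t) @[t --> F] --> \sum_i l i.
Proof. by move=> fl; apply: cvg_big => //; exact: add_continuous. Qed.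

End Norm.

Section MeanValue.
Context {R : realType}.

(** Derivability is asked on the whole ball around [a], not only on the segment, so that increments
    of either sign are covered by one statement. *)
Lemma MVT_unordered (f df : R -> R) (a b : R) :
  (forall c, `|c - a| <= `|b - a| -> is_derive c 1 f (df c)) ->
  exists2 c, `|c - a| <= `|b - a| & f b - f a = df c * (b - a).
Proof.
move=> fdf; have [ab|ba] := leP a b.
- have inab c : a <= c <= b -> `|c - a| <= `|b - a|.
    by move=> /andP[ac cb]; rewrite !ger0_norm ?subr_ge0// lerB.
  have [| |c] := @MVT_segment _ f df a b ab.
  + by move=> c; rewrite in_itv/= => /andP[ac cb]; apply/fdf/inab; rewrite !ltW.
  + apply: derivable_within_continuous => c; rewrite in_itv/= => acb.
    by have [] := fdf c (inab _ acb).
  + by rewrite in_itv/= => acb E; exists c => //; exact: inab.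
- have inab c : b <= c <= a -> `|c - a| <= `|b - a|.
    move=> /andP[bc ca]; rewrite !ler0_norm ?subr_le0// ?lerN2 ?lerB//.
    exact: ltW.
  have [| |c] := @MVT_segment _ f df b a (ltW ba).
  + by move=> c; rewrite in_itv/= => /andP[ac cb]; apply/fdf/inab; rewrite !ltW.
  + apply: derivable_within_continuous => c; rewrite in_itv/= => acb.
    by have [] := fdf c (inab _ acb).
  + rewrite in_itv/= => acb E; exists c; first exact: inab.
    by rewrite -opprB E -mulrN opprB.
Qed.

Lemma is_derive_line (V : normedModType R) (f : V -> R) x v t :
  derivable f (x + t *: v) v ->
  is_derive t 1 (fun s => f (x + s *: v)) ('D_v f (x + t *: v)).
Proof.
move=> df; have E : (fun h => h^-1 *: (f (x + (h *: 1 + t) *: v) - f (x + t *: v))) =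
   (fun h => h^-1 *: (f (h *: v + (x + t *: v)) - f (x + t *: v))).
  apply/funext => h; rewrite [h *: 1]mulr1 scalerDl.
  by rewrite [h *: v + (_ + _)]addrCA.
by split; rewrite /derivable /derive/= E.
Qed.

Lemma directional_MVT (V : normedModType R) (f : V -> R) x v h :
  (forall s, `|s| <= `|h| -> derivable f (x + s *: v) v) ->
  exists2 s, `|s| <= `|h| & f (x + h *: v) - f x = 'D_v f (x + s *: v) * h.
Proof.
move=> df.
have [|c ch] := @MVT_unordered (fun s => f (x + s *: v))
    (fun s => 'D_v f (x + s *: v)) 0 h.
  by move=> c; rewrite !subr0 => /df; exact: is_derive_line.
rewrite !subr0 in ch *; rewrite scale0r addr0 => E; by exists c.
Qed.

End MeanValue.

Section Increments.
Context {R : realType} {n : nat}.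
Local Notation V := 'rV[R]_n.

(* Telescoping over the coordinates, changed from those of z to those of y one at a time. *)
Lemma increment_partial (f : V -> R) (y z : V) :
  (forall w, `|w - z| <= `|y - z| -> forall i, derivable f w (delta_mx 0 i)) ->
  exists2 xi : 'I_n -> V, forall i, `|xi i - z| <= `|y - z| &
    f y - f z = \sum_i partial i f (xi i) * (y 0 i - z 0 i).
Proof.
move=> df.
pose w k : V := \row_i (if (i < k)%N then y 0 i else z 0 i).
have wS (i : 'I_n) : w i.+1 = w i + (y 0 i - z 0 i) *: delta_mx 0 i.
  apply/rowP => j; rewrite !mxE eqxx/= ltnS.
  have [->|ij] := eqVneq j i; first by rewrite leqnn ltnn mulr1 addrC subrK.
  by rewrite leq_eqVlt -[(_ == _ :> nat)]/(j == i) (negbTE ij) mulr0 addr0.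
(* The norm is the maximum of the entries, so changing the coordinates one at a time never leaves
   the ball of radius [|y - z|] around [z]. *)
have wz (i : 'I_n) s : `|s| <= `|y 0 i - z 0 i| ->
    `|w i + s *: delta_mx 0 i - z| <= `|y - z|.
  move=> si; apply: norm_le_entry => // a j; rewrite ord1 !mxE eqxx/=.
  have [->|ij] := eqVneq j i.
    rewrite ltnn mulr1 addrAC subrr add0r (le_trans si)//.
    by have := entry_le_norm (y - z) 0 i; rewrite !mxE.
  rewrite mulr0 addr0; case: ifP => _; last by rewrite subrr normr0.
  by have := entry_le_norm (y - z) 0 j; rewrite !mxE.
have H (i : 'I_n) : exists p : V, `|p - z| <= `|y - z| /\
    f (w i.+1) - f (w i) = partial i f p * (y 0 i - z 0 i).
  have [|s si E] := @directional_MVT _ _ f (w i) (delta_mx 0 i) (y 0 i - z 0 i).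
    by move=> s /wz /df.
  by exists (w i + s *: delta_mx 0 i); split; [exact: wz|rewrite wS].
have [xi xiP] := choice H; exists xi; first by move=> i; have [] := xiP i.
have -> : f y - f z = f (w n) - f (w 0%N).
  congr (f _ - f _); apply/rowP => j; rewrite !mxE ?ltn_ord//.
rewrite -(telescope_sumr (f \o w))// big_mkord.
by apply: eq_bigr => i _; have [_ <-] := xiP i.
Qed.

Lemma cvg_is_derive (W U : normedModType R) (f : W -> U) p v (df : U) :
  (h^-1 *: (f (h *: v + p) - f p)) @[h --> 0^'] --> df -> is_derive p v f df.
Proof.
move=> fdf; split; first by apply/cvg_ex; exists df.
exact: cvg_lim fdf.
Qed.

Lemma is_derive_cvg (W U : normedModType R) (f : W -> U) p v (df : U) :
  is_derive p v f df -> (h^-1 *: (f (h *: v + p) - f p)) @[h --> 0^'] --> df.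
Proof. by move=> [fd <-]; exact: fd. Qed.

(** The increment of [f] is a sum of partial derivatives at intermediate points times increments of
    the coordinates of [X]. The intermediate points tend to [X p], where the partial derivatives are
    continuous. *)
Lemma chain_rule (W : normedModType R) (f : V -> R) (X : W -> V) p v
    (dX : 'I_n -> R) :
  (\forall x \near X p, forall i, derivable f x (delta_mx 0 i)) ->
  (forall i, {for X p, continuous (partial i f)}) ->
  (forall i, is_derive p v (fun q => X q 0 i) (dX i)) ->
  is_derive p v (f \o X) (\sum_i partial i f (X p) * dX i).
Proof.
move=> df cf dXi.
have Xh : X (h *: v + p) @[h --> 0] --> X p.
  apply: cvg_entries => a i; rewrite ord1.
  have [/derivable1P/derivable1_diffP/differentiable_continuous dc _] := dXi i.
  by have := dc; rewrite /prop_for/= /continuous_at scale0r add0r.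
have [r r0 rf] : exists2 r : R, 0 < r & forall x, `|x - X p| <= r ->
    forall i, derivable f x (delta_mx 0 i).
  move/nbhs_ballP : df => [r /= r0 rf]; exists (r / 2); first exact: divr_gt0.
  move=> x xs; apply: rf; rewrite -ball_normE/= distrC (le_lt_trans xs)//.
  by rewrite ltr_pdivrMr// ltr_pMr// ltr1n.
(* When [X (h *: v + p)] is farther than [r] from [X p] the points are arbitrary; only small [h]
   matter for the limit. *)
have /choice[xi xiP] : forall h, exists xi : 'I_n -> V,
    `|X (h *: v + p) - X p| <= r ->
    (forall i, `|xi i - X p| <= `|X (h *: v + p) - X p|) /\
    f (X (h *: v + p)) - f (X p) =
      \sum_i partial i f (xi i) * (X (h *: v + p) 0 i - X p 0 i).
  move=> h; have [Xr|] := leP `|X (h *: v + p) - X p| r; last first.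
    by exists (fun=> 0).
  have [|xi xi1 xi2] := @increment_partial f (X (h *: v + p)) (X p); last first.
    by exists xi.
  by move=> w wX; apply: rf; exact: le_trans wX Xr.
have Xr : \forall h \near 0, `|X (h *: v + p) - X p| <= r.
  by move/cvgrPdist_le : Xh => /(_ _ r0); apply: filterS => h; rewrite distrC.
have xicvg i : xi h i @[h --> 0] --> X p.
  apply/cvgrPdist_le => e e0; move/cvgrPdist_le : Xh => /(_ _ e0).
  apply: filterS2 Xr => h Xhr Xhe; have [xih _] := xiP h Xhr.
  by rewrite distrC (le_trans (xih i))// distrC.
apply: cvg_is_derive.
have : (\sum_i partial i f (xi h i) *
    (h^-1 *: (X (h *: v + p) 0 i - X p 0 i))) @[h --> 0^'] -->
    \sum_i partial i f (X p) * dX i.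
  apply: cvg_sumr => i; apply: cvgM; last exact: is_derive_cvg.
  apply: (@cvg_comp _ _ _ (xi^~ i) (partial i f) _ (nbhs (X p))); last exact: cf.
  by apply: cvg_trans (xicvg i); apply: cvg_fmap2; exact: nbhs_dnbhs.
apply: cvg_trans; apply: near_eq_cvg; move/nbhs_dnbhs : Xr.
apply: filterS => h Xhr; have [_ /= ->] := xiP h Xhr.
rewrite scaler_sumr; apply: eq_bigr => i _.
by rewrite /GRing.scale/= mulrCA.
Qed.

End Increments.

Section PointwiseDerivatives.
Context {R : realType} {W : normedModType R}.
Implicit Types f g : W -> R.

Lemma is_derive_sum_pointwise (I : finType) (f : I -> W -> R) (df : I -> R) p v :
  (forall i, is_derive p v (f i) (df i)) ->
  is_derive p v (fun q => \sum_i f i q) (\sum_i df i).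
Proof.
move=> fdf; suff : forall s : seq I, is_derive p v (fun q => \sum_(i <- s) f i q)
    (\sum_(i <- s) df i) by exact.
elim=> [|i s IH].
  under eq_fun do rewrite big_nil.
  by rewrite big_nil; exact: is_derive_cst.
under eq_fun do rewrite big_cons.
by rewrite big_cons; exact: (is_deriveD (fdf i) IH).
Qed.

Lemma is_derive_mul_pointwise f g p v (df dg : R) :
  is_derive p v f df -> is_derive p v g dg ->
  is_derive p v (fun q => f q * g q) (df * g p + f p * dg).
Proof.
move=> fdf gdg; apply: (is_derive_eq (is_deriveM fdf gdg)).
by rewrite addrC [X in X + _ = _]mulrC.
Qed.

End PointwiseDerivatives.

(** * Smooth functions: closure properties and symmetry of mixed derivatives *)

Section Smooth.
Context {R : realType} {n : nat}.
Local Notation V := 'rV[R]_n.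
Implicit Types (f g : V -> R) (D : set V).

Lemma smooth_continuous D f x : smooth_on D f -> D x -> {for x, continuous f}.
Proof. by move=> fD Dx; have [] := fD [::] x Dx. Qed.

Lemma smooth_derivable D f x i :
  smooth_on D f -> D x -> derivable f x (delta_mx 0 i).
Proof. by move=> fD Dx; have [] := fD [::] x Dx. Qed.

Lemma smooth_partial D f i : smooth_on D f -> smooth_on D (partial i f).
Proof. by move=> fD s x Dx; have := fD (rcons s i) x Dx; rewrite foldr_rcons. Qed.

Lemma smooth_is_derive D f x i : smooth_on D f -> D x ->
  is_derive x (delta_mx 0 i) f (partial i f x).
Proof. by move=> fD Dx; apply: derivableP; exact: smooth_derivable fD Dx. Qed.

(* This class is stable under partial derivatives, hence contains only smooth functions. *)
Inductive smooth_generated D : (V -> R) -> Prop :=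
| SmoothBase f : smooth_on D f -> smooth_generated D f
| SmoothExt f g : {in D, f =1 g} -> smooth_generated D f -> smooth_generated D g
| SmoothAdd f g : smooth_generated D f -> smooth_generated D g ->
    smooth_generated D (f + g)
| SmoothMul f g : smooth_generated D f -> smooth_generated D g ->
    smooth_generated D (f * g)
| SmoothOpp f : smooth_generated D f -> smooth_generated D (- f)
| SmoothInv f : (forall x, D x -> f x != 0) -> smooth_generated D f ->
    smooth_generated D (fun x => (f x)^-1).

Lemma near_eq_continuous (T U : topologicalType) (f g : T -> U) x :
  (\near x, f x = g x) -> {for x, continuous f} -> {for x, continuous g}.
Proof.
move=> fg cf; have fgx : f x = g x := nbhs_singleton fg.
rewrite /prop_for /continuous_at -fgx; apply: cvg_trans cf.
by apply: near_eq_cvg; apply: filterS fg.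
Qed.

Lemma smooth_generatedP D f : open D -> smooth_generated D f ->
  [/\ forall x, D x -> {for x, continuous f},
      forall x, D x -> forall i, derivable f x (delta_mx 0 i) &
      forall i, smooth_generated D (partial i f)].
Proof.
move=> oD; elim=> {f} [f fD|f g fg _ [cf df pf]|f g gf [cf df pf] gg [cg dg pg]
  |f g gf [cf df pf] gg [cg dg pg]|f gf [cf df pf]|f f0 gf [cf df pf]].
- split=> [x Dx|x Dx i|i]; [exact: smooth_continuous fD Dx
    |exact: smooth_derivable fD Dx|exact/SmoothBase/smooth_partial].
- have nfg x : D x -> \near x, f x = g x.
    move=> Dx; have := open_nbhs_nbhs (conj oD Dx).
    by apply: filterS => y Dy; apply: fg; exact: mem_set.
  split=> [x Dx|x Dx i|i]; first exact: near_eq_continuous (nfg _ Dx) (cf _ Dx).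
    exact: near_eq_derivable (nfg _ Dx) (df _ Dx i).
  apply: SmoothExt (pf i) => x /set_mem Dx; exact: near_eq_derive (nfg _ Dx).
- split=> [x Dx|x Dx i|i]; first by apply: continuousD; [exact: cf|exact: cg].
    by apply: derivableD; [exact: df|exact: dg].
  apply: SmoothExt (SmoothAdd (pf i) (pg i)) => x /set_mem Dx.
  by rewrite /partial deriveD//; [exact: df|exact: dg].
- split=> [x Dx|x Dx i|i]; first by apply: continuousM; [exact: cf|exact: cg].
    by apply: derivableM; [exact: df|exact: dg].
  apply: SmoothExt (SmoothAdd (SmoothMul gf (pg i)) (SmoothMul gg (pf i))).
  move=> x /set_mem Dx.
  by rewrite /partial deriveM//; [exact: df|exact: dg].
- split=> [x Dx|x Dx i|i]; first by apply: continuousN; exact: cf.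
    by apply: derivableN; exact: df.
  apply: SmoothExt (SmoothOpp (pf i)) => x /set_mem Dx.
  by rewrite /partial deriveN//; exact: df.
- split=> [x Dx|x Dx i|i]; first by apply: continuousV; [exact: f0|exact: cf].
    by apply: derivableV; [exact: f0|exact: df].
  have gV := SmoothInv f0 gf.
  apply: SmoothExt (SmoothOpp (SmoothMul (SmoothMul gV gV) (pf i))).
  move=> x /set_mem Dx.
  rewrite /partial deriveV//; [|exact: f0|exact: df].
  by rewrite -[LHS]mulNr -expr2 -exprVn.
Qed.

Lemma smooth_generated_smooth D f :
  open D -> smooth_generated D f -> smooth_on D f.
Proof.
(* The innermost derivative is the last entry of the list, and it is this one that stability of the
   class absorbs. *)
move=> oD gf s; elim/last_ind: s f gf => [|s i IH] f gf x Dx.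
  by have [cf df _] := smooth_generatedP oD gf; split; [exact: cf|exact: df].
rewrite foldr_rcons; apply: IH => //.
by have [_ _] := smooth_generatedP oD gf.
Qed.

Section Closure.
Variables (D : set V) (oD : open D).

Lemma smooth_cst a : smooth_on D (fun=> a).
Proof.
move=> s x Dx; have [b ->] : exists b, foldr partial (fun=> a) s = (fun=> b).
  elim: s => [|i s [b IH]]; first by exists a.
  by exists 0; rewrite /= IH; apply/funext => y; rewrite /partial derive_cst.
by split=> [|i]; [exact: cst_continuous|exact: derivable_cst].
Qed.

Lemma smooth_ext f g : (forall x, D x -> f x = g x) ->
  smooth_on D f -> smooth_on D g.
Proof.
move=> fg fD; apply: smooth_generated_smooth => //.
by apply: SmoothExt (SmoothBase fD) => x /set_mem /fg.
Qed.

Lemma smoothD f g : smooth_on D f -> smooth_on D g ->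
  smooth_on D (fun x => f x + g x).
Proof.
move=> fD gD; apply: smooth_generated_smooth => //.
exact: SmoothAdd (SmoothBase fD) (SmoothBase gD).
Qed.

Lemma smoothM f g : smooth_on D f -> smooth_on D g ->
  smooth_on D (fun x => f x * g x).
Proof.
move=> fD gD; apply: smooth_generated_smooth => //.
exact: SmoothMul (SmoothBase fD) (SmoothBase gD).
Qed.

Lemma smoothN f : smooth_on D f -> smooth_on D (fun x => - f x).
Proof.
move=> fD; apply: smooth_generated_smooth => //.
exact: SmoothOpp (SmoothBase fD).
Qed.

Lemma smoothB f g : smooth_on D f -> smooth_on D g ->
  smooth_on D (fun x => f x - g x).
Proof. by move=> fD gD; exact: smoothD fD (smoothN gD). Qed.

Lemma smoothV f : (forall x, D x -> f x != 0) -> smooth_on D f ->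
  smooth_on D (fun x => (f x)^-1).
Proof.
move=> f0 fD; apply: smooth_generated_smooth => //.
exact: SmoothInv f0 (SmoothBase fD).
Qed.

Lemma smooth_sum (I : Type) (r : seq I) (P : pred I) (F : I -> V -> R) :
  (forall i, P i -> smooth_on D (F i)) ->
  smooth_on D (fun x => \sum_(i <- r | P i) F i x).
Proof.
move=> FD; elim: r => [|i r IH].
  by apply: smooth_ext (smooth_cst 0) => x _; rewrite big_nil.
have [Pi|/negbTE Pi] := boolP (P i).
  by apply: smooth_ext (smoothD (FD i Pi) IH) => x _; rewrite big_cons Pi.
by apply: smooth_ext IH => x _; rewrite big_cons Pi.
Qed.

Lemma smooth_prod (I : Type) (r : seq I) (P : pred I) (F : I -> V -> R) :
  (forall i, P i -> smooth_on D (F i)) ->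
  smooth_on D (fun x => \prod_(i <- r | P i) F i x).
Proof.
move=> FD; elim: r => [|i r IH].
  by apply: smooth_ext (smooth_cst 1) => x _; rewrite big_nil.
have [Pi|/negbTE Pi] := boolP (P i).
  by apply: smooth_ext (smoothM (FD i Pi) IH) => x _; rewrite big_cons Pi.
by apply: smooth_ext IH => x _; rewrite big_cons Pi.
Qed.

Lemma smooth_det m (F : V -> 'M[R]_m) :
  (forall i j, smooth_on D (fun x => F x i j)) ->
  smooth_on D (fun x => \det (F x)).
Proof.
move=> FD; apply: smooth_sum => s _; apply: smoothM; first exact: smooth_cst.
by apply: smooth_prod => i _; exact: FD.
Qed.

(** Cramer's rule: each entry is a cofactor, at the transposed position, divided by the
    determinant. *)
Lemma smooth_invmx m (F : V -> 'M[R]_m) :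
  (forall i j, smooth_on D (fun x => F x i j)) ->
  (forall x, D x -> F x \in unitmx) ->
  forall i j, smooth_on D (fun x => invmx (F x) i j).
Proof.
move=> FD FU i j.
have := smoothM (smoothV _ (smooth_det FD)) (smoothM (smooth_cst ((-1) ^+ (j + i)))
  (smooth_det (F := fun x => row' j (col' i (F x))) _)).
have H1 x : D x -> \det (F x) != 0 by move=> /FU; rewrite unitmxE unitfE.
have H2 a b : smooth_on D (fun x => row' j (col' i (F x)) a b).
  by apply: smooth_ext (FD (lift j a) (lift i b)) => x _; rewrite !mxE.
move=> /(_ H1 H2); apply: smooth_ext => x Dx.
by rewrite /invmx FU// !mxE.
Qed.

End Closure.

Lemma derivable_shift f x c v : derivable f (x + c) v ->
  is_derive x v (fun y => f (y + c)) ('D_v f (x + c)).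
Proof.
move=> df; have E : (fun h => h^-1 *: (f (h *: v + x + c) - f (x + c))) =
   (fun h => h^-1 *: (f (h *: v + (x + c)) - f (x + c))).
  by apply/funext => h; rewrite addrA.
by split; rewrite /derivable /derive/= E.
Qed.

(** The mean value theorem is applied twice: in direction i to the function y -> f (y + h e_j) - f
    y, then in direction j to [partial i f]. *)
Lemma second_difference f x h (i j : 'I_n) :
  (forall s t, `|s| <= `|h| -> `|t| <= `|h| ->
    let y := x + s *: delta_mx 0 i + t *: delta_mx 0 j in
    derivable f y (delta_mx 0 i) /\ derivable (partial i f) y (delta_mx 0 j)) ->
  exists s t, [/\ `|s| <= `|h|, `|t| <= `|h| &
    f (x + h *: delta_mx 0 i + h *: delta_mx 0 j) - f (x + h *: delta_mx 0 i)
      - (f (x + h *: delta_mx 0 j) - f x)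
    = partial j (partial i f) (x + s *: delta_mx 0 i + t *: delta_mx 0 j) * h * h].
Proof.
set ei := delta_mx 0 i; set ej := delta_mx 0 j => df.
have dG s : `|s| <= `|h| -> is_derive (x + s *: ei) ei
    ((fun y => f (y + h *: ej)) - f)
    (partial i f (x + s *: ei + h *: ej) - partial i f (x + s *: ei)).
  move=> sh; have [d1 _] := df s h sh (lexx _).
  have [d2 _] := df s 0 sh ltac:(by rewrite normr0).
  rewrite scale0r addr0 in d2.
  exact: (is_deriveB (derivable_shift d1) (derivableP d2)).
have [s sh|s sh] := @directional_MVT _ _ ((fun y => f (y + h *: ej)) - f) x ei h.
  by have [] := dG s sh.
have [_ ->] := dG s sh.
have [t th|t th ->] := @directional_MVT _ _ (partial i f) (x + s *: ei) ej h.
  by have [] := df s t sh th.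
by move=> E; exists s, t.
Qed.

(** The second difference is symmetric in i and j, so the two mixed derivatives agree at two points
    arbitrarily close to [x]; continuity transfers this to [x] up to any [e]. *)
Lemma partialC D f x i j : open D -> D x -> smooth_on D f ->
  partial i (partial j f) x = partial j (partial i f) x.
Proof.
move=> oD Dx fD; apply/eqP; rewrite -subr_eq0 -normr_le0; apply/ler_addgt0Pl.
move=> e e0; rewrite addr0.
have ci := smooth_continuous (smooth_partial i (smooth_partial j fD)) Dx.
have cj := smooth_continuous (smooth_partial j (smooth_partial i fD)) Dx.
have e20 : 0 < e / 2 by exact: divr_gt0.
have nD : \forall y \near x, D y by exact: open_nbhs_nbhs (conj oD Dx).
move/cvgrPdist_le : ci => /(_ _ e20) ni; move/cvgrPdist_le : cj => /(_ _ e20) nj.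
have [r /= r0 rD] := (nbhs_ballP _ _).1 (filterI nD (filterI ni nj)).
(* Two displacements of size at most [r / 4] stay strictly inside the ball of radius [r]. *)
pose h := r / 4.
have h0 : 0 < h by rewrite divr_gt0.
have inD s t k l : `|s| <= `|h| -> `|t| <= `|h| ->
    ball x r (x + s *: delta_mx 0 k + t *: delta_mx 0 l).
  move=> sh th; rewrite -ball_normE/= distrC -(addrA x) addrAC subrr add0r.
  rewrite (le_lt_trans (ler_normD _ _))// !normrZ !norm_delta !mulr1.
  rewrite (le_lt_trans (lerD sh th))// !gtr0_norm// /h; lra.
have Dst s t k l sh th := (rD _ (inD s t k l sh th)).1.
have [s t sh th|s [t [sh th E]]] := @second_difference f x h i j.
  by split; [exact: smooth_derivable fD (Dst _ _ _ _ sh th) | apply: smooth_derivable (Dst _ _ _ _ sh th);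
    exact: smooth_partial].
have [s' t' sh' th'|s' [t' [sh' th' E']]] := @second_difference f x h j i.
  by split; [exact: smooth_derivable fD (Dst _ _ _ _ sh' th') | apply: smooth_derivable (Dst _ _ _ _ sh' th');
    exact: smooth_partial].
have [_ [_ a1]] := rD _ (inD _ _ i j sh th).
have [_ [a2 _]] := rD _ (inD _ _ j i sh' th').
have EE : partial j (partial i f) (x + s *: delta_mx 0 i + t *: delta_mx 0 j) =
   partial i (partial j f) (x + s' *: delta_mx 0 j + t' *: delta_mx 0 i).
  apply: (mulIf (lt0r_neq0 h0)); apply: (mulIf (lt0r_neq0 h0)).
  apply: etrans (esym E) (etrans _ E').
  rewrite (addrAC x); move: (f _) (f _) (f _) (f _) => a b c d; ring.
rewrite EE in a1; rewrite (splitr e); apply: le_trans (lerD a2 a1).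
by rewrite [X in _ <= _ + X]distrC; exact: ler_distD.
Qed.

End Smooth.

(** * Existence of geodesics *)

Section Primitive.
Context {R : realType}.

Lemma exists_primitive (h : R -> R) (b : R) : 0 < b -> continuous h ->
  exists2 H : R -> R, H 0 = 0 & forall t : R, `|t| < b -> is_derive t 1 H (h t).
Proof.
move=> b0 ch.
(* The integral starts at [- b], so that 0 and all [t] of either sign with [|t| < b] are interior
   points for the fundamental theorem. *)
pose F (y : R) := (\int[lebesgue_measure]_(t in `[- b, y]) h t)%R.
exists (fun y => F y - F 0); first by rewrite subrr.
move=> t; rewrite ltr_norml => /andP[bt tb].
have hint : lebesgue_measure.-integrable `[- b, b] (EFin \o h).
  apply: continuous_compact_integrable; first exact: segment_compact.
  exact: continuous_subspaceT.
have [dF F't] := continuous_FTC1_closed tb hint bt (ch t).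
rewrite -[h t]subr0 -F't derive1E.
exact: (is_deriveB (derivableP dF) (is_derive_cst (F 0) t 1)).
Qed.

End Primitive.

Section Picard.
Context {R : realType} {N : nat}.
Local Notation V := 'rV[R]_N.

(** This Archimedean principle lets estimates that hold along the Picard iterates pass to their
    limit. *)
Lemma le_geometric_half (a b c : R) :
  (forall k, a <= b + c * 2^-1 ^+ k) -> a <= b.
Proof.
move=> H; rewrite -subr_le0 leNgt; apply/negP => ab.
have := H (Num.bound (c / (a - b))).
have := upper_nthrootP (leqnn (Num.bound (c / (a - b)))).
set k := Num.bound _; rewrite ltr_pdivrMr// => ck.
rewrite leNgt => /negP; apply; rewrite -ltrBrDl.
by rewrite exprVn ltr_pdivrMr ?exprn_gt0// mulrC.
Qed.

Lemma norm_le_geometric_eq (x y : V) (c : R) :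
  (forall k, `|x - y| <= c * 2^-1 ^+ k) -> x = y.
Proof.
move=> H; apply/eqP; rewrite -subr_eq0 -normr_le0.
by apply: (@le_geometric_half _ _ c) => k; rewrite add0r.
Qed.

Lemma cvg_geometric_half (u : nat -> V) (C : R) : 0 <= C ->
  (forall k, `|u k.+1 - u k| <= C * 2^-1 ^+ k) ->
  exists l : V, forall k, `|l - u k| <= C * 2 * 2^-1 ^+ k.
Proof.
move=> C0 uC.
have uD k m : `|u (k + m)%N - u k| <= C * 2 * 2^-1 ^+ k.
  (* Induction on [m] needs the exact partial sum of the geometric series, not only its bound. *)
  suff : `|u (k + m)%N - u k| <= C * 2 * (2^-1 ^+ k - 2^-1 ^+ (k + m)).
    move/le_trans; apply; apply: ler_wpM2l; first exact: mulr_ge0.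
    by rewrite gerBl exprn_ge0.
  elim: m => [|m IH]; first by rewrite addn0 !subrr mulr0 normr0.
  rewrite addnS -(subrK (u (k + m)%N) (u _.+1)) -addrA.
  apply: le_trans (ler_normD _ _) (le_trans (lerD (uC _) IH) _).
  by rewrite exprS; move: (2^-1 ^+ _) (2^-1 ^+ _) => a b; lra.
have small e : 0 < e -> exists k, C * 2 * 2^-1 ^+ k < e.
  move=> e0; apply: contrapT => /forallNP H.
  suff : e <= 0 by rewrite leNgt e0.
  apply: (@le_geometric_half _ _ (C * 2)) => k; rewrite add0r leNgt.
  exact/negP/H.
have /cauchy_cvgP/cvg_ex[/= l ul] : cauchy (u @ \oo).
  apply: cauchy_exP => e /= /small[k ke]; exists (u k); exists k => // m /= km.
  by rewrite -ball_normE/= distrC -(subnKC km) (le_lt_trans (uD _ _)).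
exists l => k; apply/ler_addgt0Pr => e e0.
move/cvgrPdist_le : ul => /(_ _ e0)[m _ um].
have := um (k + m)%N (leq_addl _ _) => /= lm.
rewrite -(subrK (u (k + m)%N) l) -addrA addrC.
apply: le_trans (ler_normD _ _) _.
exact: lerD.
Qed.

Lemma lipschitz_continuous (W : normedModType R) (f : R -> W) (B : R) : 0 <= B ->
  (forall s t, `|f s - f t| <= B * `|s - t|) -> continuous f.
Proof.
move=> B0 fB t; apply/cvgrPdist_le => e e0.
have d0 : 0 < e / (B + 1) by rewrite divr_gt0// ltr_wpDl.
apply/nbhs_ballP; exists (e / (B + 1)) => //= s st.
apply: le_trans (fB _ _) _; apply: (@le_trans _ _ ((B + 1) * `|t - s|)).
  by rewrite ler_wpM2r// lerDl.
by rewrite mulrC -ler_pdivlMr ?ltW// ltr_wpDl.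
Qed.

(* Clamping the time makes all estimates on the Picard iterates uniform on the whole line. *)
Definition clamp (d t : R) : R := Num.max (- d) (Num.min d t).

Lemma clamp_le d t : 0 <= d -> `|clamp d t| <= d.
Proof.
move=> d0; rewrite ler_norml /clamp; have [h1|h1] := leP d t.
  by have [h2|h2] := leP (- d) d; apply/andP; split; lra.
by have [h2|h2] := leP (- d) t; apply/andP; split; lra.
Qed.

Lemma clamp_lip d s t : `|clamp d s - clamp d t| <= `|s - t|.
Proof.
have max_lip (a x y : R) : `|Num.max a x - Num.max a y| <= `|x - y|.
  rewrite ler_norml; have [?|?] := leP a x; have [?|?] := leP a y;
  case: (ler0P (x - y)) => ?; apply/andP; split; lra.
have min_lip (a x y : R) : `|Num.min a x - Num.min a y| <= `|x - y|.
  rewrite ler_norml; have [?|?] := leP a x; have [?|?] := leP a y;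
  case: (ler0P (x - y)) => ?; apply/andP; split; lra.
exact: le_trans (max_lip _ _ _) (min_lip _ _ _).
Qed.

Lemma clamp_id d t : `|t| <= d -> clamp d t = t.
Proof. by rewrite ler_norml => /andP[h1 h2]; rewrite /clamp min_r// max_r. Qed.

Lemma clampK d t : 0 <= d -> clamp d (clamp d t) = clamp d t.
Proof. by move=> d0; rewrite clamp_id// clamp_le. Qed.

Section Iteration.
Variables (f : V -> V) (x0 : V) (L B : R).
Hypotheses (L0 : 0 < L) (B0 : 0 < B).
Hypothesis f_lip : forall x y, `|f x - f y| <= L * `|x - y|.
Hypothesis f_bnd : forall x, `|f x| <= B.

(** The half-length of the time interval is chosen so that [L * d] is 1/2, the contraction factor of
    the Picard operator. *)
Let d := (2 * L)^-1.
Let d0 : 0 < d. Proof. by rewrite invr_gt0 mulr_gt0. Qed.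

Let clamp_le t : `|clamp d t| <= d. Proof. exact: clamp_le (ltW d0). Qed.

(** The relation says that [w'] is a primitive [P] of f(w), frozen outside [-d, d]. The primitive is
    taken on the longer interval [4 * d] because the mean value points for clamped times satisfy
    only [|c| <= 3 * d]. *)
Let picard (w w' : R -> V) := exists P : R -> V, [/\ P 0 = x0,
  forall t, w' t = P (clamp d t) &
  forall (t : R) i, `|t| < 4 * d -> is_derive t 1 (fun s => P s 0 i) (f (w t) 0 i)].

Let clamp_lt s t c : `|c - clamp d t| <= `|clamp d s - clamp d t| -> `|c| < 4 * d.
Proof.
move=> H; rewrite -(subrK (clamp d t) c) (le_lt_trans (ler_normD _ _))//.
have := clamp_le s; have := clamp_le t; have := ler_normB (clamp d s) (clamp d t).
move: H d0; lra.
Qed.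

Let picard_step w : continuous w -> exists w', picard w w'.
Proof.
move=> cw.
have cfw i : continuous (fun t => f (w t) 0 i).
  move=> t; apply/cvgrPdist_le => e e0.
  have eL0 : 0 < e / L by rewrite divr_gt0.
  move/cvgrPdist_le : (cw t) => /(_ _ eL0); apply: filterS => s.
  rewrite ler_pdivlMr// mulrC => ws.
  have := entry_le_norm (f (w t) - f (w s)) 0 i; rewrite !mxE => /le_trans; apply.
  exact: le_trans (f_lip _ _) ws.
have dd0 : 0 < 4 * d by rewrite mulr_gt0.
have H i : exists H : R -> R, H 0 = 0 /\
    forall t : R, `|t| < 4 * d -> is_derive t 1 H (f (w t) 0 i).
  by have [H ? ?] := exists_primitive dd0 (cfw i); exists H.
have [P PP] := choice H.
pose Q t := x0 + \row_i P i t.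
exists (Q \o clamp d), Q; split=> // [|t i td].
  by apply/rowP => i; rewrite !mxE (PP i).1 addr0.
have -> : (fun s => Q s 0 i) = cst (x0 0 i) + P i.
  by apply/funext => s; rewrite /Q !mxE.
rewrite -[f (w t) 0 i]add0r.
exact: (is_deriveD (is_derive_cst (x0 0 i) t 1) ((PP i).2 t td)).
Qed.

Let picard0 w w' : picard w w' -> w' 0 = x0.
Proof. by move=> [P [P0 PE _]]; rewrite PE clamp_id ?normr0 ?ltW. Qed.

Let picard_lip w w' : picard w w' ->
  forall s t, `|w' s - w' t| <= B * `|s - t|.
Proof.
move=> [P [_ PE dP]] s t; rewrite !PE.
apply: norm_le_entry => [|a i]; first by rewrite mulr_ge0// ltW.
rewrite ord1 !mxE.
have [c /clamp_lt cd|c _ ->] := @MVT_unordered _ (fun r => P r 0 i)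
  (fun r => f (w r) 0 i) (clamp d t) (clamp d s); first exact: dP.
rewrite normrM ler_pM//; last exact: clamp_lip.
exact: le_trans (entry_le_norm _ _ _) (f_bnd _).
Qed.

(** Both primitives start at [x0] and their velocities differ by at most [L * e] during a time at
    most [d]. *)
Let picard_contraction w1 w2 w1' w2' e : picard w1 w1' -> picard w2 w2' ->
  (forall t, `|w1 t - w2 t| <= e) -> forall t, `|w1' t - w2' t| <= e * 2^-1.
Proof.
move=> [P1 [P10 PE1 dP1]] [P2 [P20 PE2 dP2]] we t; rewrite PE1 PE2.
have e0 : 0 <= e by exact: le_trans (we 0).
apply: norm_le_entry => [|a i]; first by rewrite mulr_ge0// invr_ge0.
rewrite ord1 !mxE.
have c0 : clamp d 0 = 0 by rewrite clamp_id ?normr0 ?ltW.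
pose D1 := fun r => P1 r 0 i - P2 r 0 i.
have [c|c _] := @MVT_unordered _ D1 (fun r => f (w1 r) 0 i - f (w2 r) 0 i)
    (clamp d 0) (clamp d t).
  move=> /clamp_lt cd.
  exact: (is_deriveB (dP1 c i cd) (dP2 c i cd)).
rewrite /D1 c0 P10 P20 subrr !subr0 => ->.
have -> : e * 2^-1 = L * e * d.
  by rewrite /d; field; exact: lt0r_neq0.
rewrite normrM ler_pM//.
have := entry_le_norm (f (w1 c) - f (w2 c)) 0 i; rewrite !mxE => /le_trans; apply.
by rewrite (le_trans (f_lip _ _))// ler_wpM2l// ltW.
Qed.

Lemma picard_lindelof : exists2 u : R -> V, u 0 = x0 & continuous u /\
  exists2 e : R, 0 < e & forall (t : R) i, `|t| < e ->
    is_derive t 1 (fun s => u s 0 i) (f (u t) 0 i).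
Proof.
(* A value is supplied for discontinuous [w] too, so that choice yields a total operator [T] that
   can be iterated. *)
have H w : exists w', continuous w -> picard w w'.
  have [cw|] := pselect (continuous w); last by exists w.
  by have [w' ?] := picard_step cw; exists w'.
have [T TP] := choice H.
pose w k := iter k T (fun=> x0).
have cw k : continuous (w k).
  elim: k => [|k IH]; first by move=> t; exact: cvg_cst.
  exact: lipschitz_continuous (ltW B0) (picard_lip (TP _ IH)).
(* This bounds the first step: [w 1] is [B]-Lipschitz, equals [x0] at time 0 and depends only on the
   clamped time. *)
pose C := B * d.
have C0 : 0 <= C by rewrite mulr_ge0// ltW.
have wC k t : `|w k.+1 t - w k t| <= C * 2^-1 ^+ k.
  elim: k t => [|k IH] t; last first.
    rewrite exprSr mulrA.
    exact: (picard_contraction (TP _ (cw k.+1)) (TP _ (cw k)) IH).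
  have P1 := TP _ (cw 0%N).
  rewrite expr0 mulr1 -[X in _ - X](picard0 P1).
  have [P [_ PE _]] := P1.
  have -> : w 1%N t = T (w 0%N) (clamp d t).
    by rewrite [LHS]PE PE clampK ?ltW.
  rewrite (le_trans (picard_lip P1 _ _))// subr0 ler_wpM2l// ltW//.
have /choice[u uP] t : exists l : V, forall k, `|l - w k t| <= C * 2 * 2^-1 ^+ k.
  exact: (cvg_geometric_half C0 (wC^~ t)).
(* The limit inherits the Lipschitz constant [B] of the iterates, the error terms being of order
   2^-k. *)
have cu : continuous u.
  apply: (@lipschitz_continuous _ _ B (ltW B0)) => s t.
  apply: (@le_geometric_half _ _ (C * 2 + C * 2)) => k.
  have -> : u s - u t = (w k s - w k t) + ((u s - w k s) - (u t - w k t)).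
    move: (w k s) (w k t) (u s) (u t) => a b x y.
    by apply/rowP => i; rewrite !mxE; ring.
  rewrite mulrDl; apply: le_trans (ler_normD _ _) (lerD _ _).
    case: k => [|k]; first by rewrite subrr normr0 mulr_ge0// ltW.
    exact: picard_lip (TP _ (cw k)) _ _.
  exact: le_trans (ler_normB _ _) (lerD (uP _ _) (uP _ _)).
have [P [P0 PE dP]] := TP u cu.
(* Fixed point: [u] and its Picard image are both within a constant times 2^-k of [w k.+1], for
   every k. *)
have uE t : u t = P (clamp d t).
  rewrite -PE; apply: (@norm_le_geometric_eq _ _ (C * 2 * 2)) => k.
  rewrite -(subrKA (w k.+1 t)) (le_trans (ler_normD _ _))//.
  have -> : C * 2 * 2 * 2^-1 ^+ k = C * 2 * 2^-1 ^+ k + C * 2 * 2^-1 ^+ k.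
    by move: (2^-1 ^+ k) => q; ring.
  rewrite lerD//.
    apply: le_trans (uP _ _) _; apply: ler_wpM2l; first exact: mulr_ge0.
    by rewrite exprS ler_piMl ?exprn_ge0// invf_le1// ler1n.
  rewrite distrC.
  apply: le_trans (picard_contraction (TP _ cu) (TP _ (cw k)) (uP^~ k) _) _.
  have q0 : 0 <= C * 2 * 2^-1 ^+ k.
    by apply: mulr_ge0; [exact: mulr_ge0|exact: exprn_ge0].
  by apply: ler_piMr => //; rewrite invf_le1// ler1n.
exists u; first by rewrite uE clamp_id ?normr0 ?ltW.
split=> //; exists d => // t i td.
(* For [|t| < d] clamping is the identity near [t], so [u] has there the derivative of its
   primitive. *)
apply: near_eq_is_derive (dP t i _); last first.
  by rewrite (lt_trans td)// ltr_pMl// ltr1n.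
have /nbhs_ballP[r /= r0 rd] : \forall s \near t, `|s| < d.
  apply/nbhs_ballP; exists (d - `|t|); first by rewrite /= subr_gt0.
  move=> s st; rewrite -(subrK t s) (le_lt_trans (ler_normD _ _))//.
  by rewrite -ltrBrDr distrC.
by apply/nbhs_ballP; exists r => // s /rd sd; rewrite uE clamp_id ?ltW.
Qed.

End Iteration.
End Picard.

(** * Locally Lipschitz vector fields and local solutions *)

Section LocalLipschitz.
Context {R : realType} {N : nat}.
Local Notation V := 'rV[R]_N.

Definition locally_lipschitz (W : normedModType R) (f : V -> W) (x0 : V) :=
  exists2 r : R, 0 < r & exists2 C : R, 0 <= C & forall x y,
    `|x - x0| <= r -> `|y - x0| <= r -> `|f x - f y| <= C * `|x - y|.

Lemma locally_lipschitz_cst (W : normedModType R) (a : W) x0 :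
  locally_lipschitz (fun=> a) x0.
Proof. by exists 1 => //; exists 0 => // x y; rewrite subrr normr0 mul0r. Qed.

Lemma locally_lipschitzD (W : normedModType R) (f g : V -> W) x0 :
  locally_lipschitz f x0 -> locally_lipschitz g x0 ->
  locally_lipschitz (fun x => f x + g x) x0.
Proof.
move=> [r r0 [C C0 fC]] [s s0 [E E0 gE]].
exists (Num.min r s); first by rewrite lt_min r0.
exists (C + E); first exact: addr_ge0.
move=> x y; rewrite !le_min => /andP[xr xs] /andP[yr ys].
rewrite opprD addrACA mulrDl (le_trans (ler_normD _ _))// lerD//.
  exact: fC.
exact: gE.
Qed.

Lemma locally_lipschitz_scale (W : normedModType R) (f : V -> R) (g : V -> W) x0 :
  locally_lipschitz f x0 -> locally_lipschitz g x0 ->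
  locally_lipschitz (fun x => f x *: g x) x0.
Proof.
move=> [r r0 [C C0 fC]] [s s0 [E E0 gE]].
have x0_near (e : R) : 0 < e -> `|x0 - x0| <= e by rewrite subrr normr0 => /ltW.
have fb x : `|x - x0| <= r -> `|f x| <= `|f x0| + C * r.
  move=> xr; rewrite -{1}(subrK (f x0) (f x)) addrC (le_trans (ler_normD _ _))//.
  by rewrite lerD2l (le_trans (fC _ _ xr (x0_near _ r0)))// ler_wpM2l.
have gb x : `|x - x0| <= s -> `|g x| <= `|g x0| + E * s.
  move=> xs; rewrite -{1}(subrK (g x0) (g x)) addrC (le_trans (ler_normD _ _))//.
  by rewrite lerD2l (le_trans (gE _ _ xs (x0_near _ s0)))// ler_wpM2l.
exists (Num.min r s); first by rewrite lt_min r0.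
exists ((`|f x0| + C * r) * E + C * (`|g x0| + E * s)).
  by rewrite addr_ge0// mulr_ge0// addr_ge0// mulr_ge0// ltW.
move=> x y; rewrite !le_min => /andP[xr xs] /andP[yr ys].
have -> : f x *: g x - f y *: g y = f x *: (g x - g y) + (f x - f y) *: g y.
  by rewrite scalerBr scalerBl addrA subrK.
rewrite mulrDl (le_trans (ler_normD _ _))// !normrZ lerD//.
  rewrite -mulrA ler_pM//; [exact: fb|exact: gE].
rewrite mulrAC ler_pM//; [exact: fC|exact: gb].
Qed.

Lemma locally_lipschitz_sum (W : normedModType R) (I : Type) (r : seq I)
    (F : I -> V -> W) x0 : (forall i, locally_lipschitz (F i) x0) ->
  locally_lipschitz (fun x => \sum_(i <- r) F i x) x0.
Proof.
move=> FL; elim: r => [|i r IH].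
  have -> : (fun x => \sum_(i <- [::]) F i x) = fun=> 0.
    by apply/funext => x; rewrite big_nil.
  exact: locally_lipschitz_cst.
have -> : (fun x => \sum_(j <- i :: r) F j x) =
    fun x => F i x + \sum_(j <- r) F j x.
  by apply/funext => x; rewrite big_cons.
exact: locally_lipschitzD.
Qed.

Lemma locally_lipschitz_coord i x0 : locally_lipschitz (fun x => x 0 i) x0.
Proof.
exists 1 => //; exists 1 => // x y _ _; rewrite mul1r.
by have := entry_le_norm (x - y) 0 i; rewrite !mxE.
Qed.

(** Composing [f] with the coordinatewise retraction [k] onto the closed ball of radius [r], which
    is 1-Lipschitz, makes it globally Lipschitz and bounded. For short times the solution stays in
    the ball, where [k] is the identity. *)
Lemma picard_lindelof_local (f : V -> V) x0 : locally_lipschitz f x0 ->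
  exists2 u : R -> V, u 0 = x0 & continuous u /\
  exists2 e : R, 0 < e & forall (t : R) i, `|t| < e ->
    is_derive t 1 (fun s => u s 0 i) (f (u t) 0 i).
Proof.
move=> [r r0 [C C0 fC]].
pose k (x : V) : V := x0 + \row_i clamp r (x 0 i - x0 0 i).
have kr x : `|k x - x0| <= r.
  rewrite addrAC subrr add0r; apply: norm_le_entry (ltW r0) _ => a i.
  by rewrite mxE; exact: clamp_le (ltW r0).
have klip x y : `|k x - k y| <= `|x - y|.
  apply: norm_le_entry => // a i; rewrite ord1 !mxE opprD addrACA subrr add0r.
  apply: le_trans (clamp_lip _ _ _) _; rewrite opprB addrACA addrA addrAC.
  rewrite -addrA; have := entry_le_norm (x - y) 0 i; rewrite !mxE.
  by congr (`|_| <= _); ring.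
have kid x : `|x - x0| <= r -> k x = x.
  move=> xr; apply/rowP => i; rewrite !mxE clamp_id; first by rewrite addrC subrK.
  by apply: le_trans xr; have := entry_le_norm (x - x0) 0 i; rewrite !mxE.
(* The added units keep both constants strictly positive, as [picard_lindelof] requires. *)
have [||x y|x|u u0 [cu [e e0 du]]] := @picard_lindelof R N (f \o k) x0 (C + 1)
    (`|f x0| + C * r + 1).
- by rewrite ltr_wpDl.
- by rewrite ltr_wpDl// addr_ge0// mulr_ge0// ltW.
- apply: le_trans (fC _ _ (kr x) (kr y)) _.
  by apply: ler_pM => //; rewrite lerDl.
- rewrite ler_wpDr// -{1}(subrK (f x0) ((f \o k) x)) addrC (le_trans (ler_normD _ _))//.
  rewrite lerD2l (le_trans (fC _ _ (kr x) _))//; last exact: ler_wpM2l.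
  by rewrite subrr normr0 ltW.
exists u => //; split=> //.
have /nbhs_ballP[e' /= e'0 ue] : \forall t \near (0 : R), `|u t - x0| <= r.
  by move/cvgrPdist_le : (cu 0) => /(_ _ r0); rewrite u0; apply: filterS => t; rewrite distrC.
exists (Num.min e e'); first by rewrite lt_min e0.
move=> t i; rewrite lt_min => /andP[te te'].
rewrite -[u t]kid; first exact: du.
by apply: ue; rewrite /ball/= sub0r normrN.
Qed.

End LocalLipschitz.

(** * Second-order equations quadratic in the velocity *)

Section SecondOrder.
Context {R : realType} {n : nat}.
Local Notation V := 'rV[R]_n.

Lemma smooth_locally_lipschitz (D : set V) (f : V -> R) x0 : open D -> D x0 ->
  smooth_on D f -> locally_lipschitz f x0.
Proof.
move=> oD Dx fD.
have nD : \forall y \near x0, D y by exact: open_nbhs_nbhs (conj oD Dx).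
have nBi i : \forall y \near x0, `|partial i f y| <= `|partial i f x0| + 1.
  have cp := smooth_continuous (smooth_partial i fD) Dx.
  move/cvgrPdist_le : cp => /(_ _ ltr01); apply: filterS => y.
  rewrite distrC => h; rewrite -(subrK (partial i f x0) (partial i f y)) addrC.
  by apply: le_trans (ler_normD _ _) _; rewrite lerD2l.
have nB : \forall y \near x0, forall i, `|partial i f y| <= `|partial i f x0| + 1.
  exact: filter_forall nBi.
have [r /= r0 rD] := (nbhs_ballP _ _).1 (filterI nD nB).
(* Points of this smaller ball are at most [r / 2] apart, so the intermediate points lie within 3r/4
   of [x0], where the partial derivatives are bounded. *)
exists (r / 4); first exact: divr_gt0.
exists (\sum_i (`|partial i f x0| + 1)); first by apply: sumr_ge0 => i _; exact: addr_ge0.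
move=> x y xr yr.
have inb w : `|w - y| <= `|x - y| -> ball x0 r w.
  move=> wy; rewrite -ball_normE/= distrC -(subrKA y).
  rewrite (le_lt_trans (ler_normD _ _))//.
  have : `|x - y| <= r / 4 + r / 4.
    rewrite -(subrKA x0) (le_trans (ler_normD _ _))// lerD//.
    by rewrite distrC.
  clear - wy yr r0; move: `|_| `|_| `|_| wy yr => a b c; lra.
have [w /inb /rD [Dw _] i|xi xiP ->] := @increment_partial _ _ f x y.
  exact: smooth_derivable fD Dw.
rewrite mulr_suml (le_trans (ler_norm_sum _ _ _))//; apply: ler_sum => i _.
rewrite normrM ler_pM//; first by have [_] := rD _ (inb _ (xiP i)).
by have := entry_le_norm (x - y) 0 i; rewrite !mxE.
Qed.

Lemma locally_lipschitz_lsubmx (f : V -> R) (z0 : 'rV[R]_(n + n)) :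
  locally_lipschitz f (lsubmx z0) ->
  locally_lipschitz (fun z : 'rV[R]_(n + n) => f (lsubmx z)) z0.
Proof.
have le_lsub (x y : 'rV[R]_(n + n)) : `|lsubmx x - lsubmx y| <= `|x - y|.
  apply: norm_le_entry => // i j; rewrite !mxE.
  by have := entry_le_norm (x - y) i (lshift n j); rewrite !mxE.
move=> [r r0 [C C0 fC]]; exists r => //; exists C => // x y xr yr.
apply: le_trans (fC _ _ (le_trans (le_lsub _ _) xr) (le_trans (le_lsub _ _) yr)) _.
by rewrite ler_wpM2l.
Qed.

(* The geodesic equation, as a first-order system on the pairs (position, velocity). *)
Lemma quadratic_ode_local (D : set V) (G : 'I_n -> 'I_n -> 'I_n -> V -> R) x0 v0 :
  open D -> D x0 -> (forall k i j, smooth_on D (G k i j)) ->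
  exists (x v : R -> V) (e : R), [/\ x 0 = x0, v 0 = v0, 0 < e, continuous x &
    forall t : R, `|t| < e -> [/\ D (x t),
      forall k, is_derive t 1 (fun s => x s 0 k) (v t 0 k) &
      forall k, is_derive t 1 (fun s => v s 0 k)
        (- \sum_i \sum_j G k i j (x t) * v t 0 i * v t 0 j)]].
Proof.
move=> oD Dx GD.
pose z0 := row_mx x0 v0.
pose acc (z : 'rV[R]_(n + n)) k := - \sum_i \sum_j G k i j (lsubmx z) *
  z 0 (rshift n i) * z 0 (rshift n j).
pose F (z : 'rV[R]_(n + n)) : 'rV[R]_(n + n) :=
  \sum_k z 0 (rshift n k) *: delta_mx 0 (lshift n k) +
  \sum_k acc z k *: delta_mx 0 (rshift n k).
have Fl z k : F z 0 (lshift n k) = z 0 (rshift n k).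
  rewrite /F mxE !summxE (bigD1 k)//= !mxE !eqxx/= mulr1 big1 ?addr0; last first.
    by move=> i ik; rewrite !mxE eq_lshift eq_sym (negbTE ik) andbF mulr0.
  by rewrite big1 ?addr0// => i _; rewrite !mxE eq_lrshift andbF mulr0.
have Fr z k : F z 0 (rshift n k) = acc z k.
  rewrite /F mxE !summxE [X in _ + X](bigD1 k)//= !mxE !eqxx/= mulr1.
  rewrite [X in _ + (_ + X)]big1 ?addr0; last first.
    by move=> i ik; rewrite !mxE eq_rshift eq_sym (negbTE ik) andbF mulr0.
  by rewrite big1 ?add0r// => i _; rewrite !mxE eq_rlshift andbF mulr0.
have lM (f g : 'rV[R]_(n + n) -> R) : locally_lipschitz f z0 ->
    locally_lipschitz g z0 -> locally_lipschitz (fun z => f z * g z) z0.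
  exact: locally_lipschitz_scale.
have accl k : locally_lipschitz (acc^~ k) z0.
  have -> : acc^~ k = fun z => (-1) * \sum_i \sum_j G k i j (lsubmx z) *
      z 0 (rshift n i) * z 0 (rshift n j).
    by apply/funext => z; rewrite mulN1r.
  apply: (lM); first exact: locally_lipschitz_cst.
  apply: locally_lipschitz_sum => i; apply: locally_lipschitz_sum => j.
  apply: (lM); last exact: locally_lipschitz_coord.
  apply: (lM); last exact: locally_lipschitz_coord.
  apply: locally_lipschitz_lsubmx; rewrite /z0 row_mxKl.
  exact: smooth_locally_lipschitz oD Dx (GD k i j).
have Flip : locally_lipschitz F z0.
  apply: locally_lipschitzD; apply: locally_lipschitz_sum => k;
    apply: locally_lipschitz_scale; try exact: locally_lipschitz_cst.
    exact: locally_lipschitz_coord.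
  exact: accl.
have [u u0 [cu [e e0 du]]] := picard_lindelof_local Flip.
have cx : continuous (fun t => lsubmx (u t)).
  move=> t; apply: cvg_entries => a i; rewrite mxE.
  under eq_cvg do rewrite mxE.
  exact: (cvg_comp _ _ (cu t) (@coord_continuous _ _ _ a (lshift n i) _)).
have nD : \forall t \near (0 : R), D (lsubmx (u t)).
  apply: (cx 0); rewrite u0 row_mxKl.
  exact: open_nbhs_nbhs (conj oD Dx).
have [e' /= e'0 ue] := (nbhs_ballP _ _).1 nD.
exists (fun t => lsubmx (u t)), (fun t => rsubmx (u t)), (Num.min e e').
split=> //; rewrite ?u0 ?row_mxKl ?row_mxKr ?lt_min ?e0//.
move=> t; rewrite lt_min => /andP[te te'].
split=> [|k|k]; first by apply: ue; rewrite /ball/= sub0r normrN.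
  under eq_fun do rewrite mxE.
  by rewrite mxE -Fl; exact: du.
under eq_fun do rewrite mxE.
have -> : - \sum_i \sum_j G k i j (lsubmx (u t)) * rsubmx (u t) 0 i * rsubmx (u t) 0 j
    = F (u t) 0 (rshift n k).
  by rewrite Fr; congr (- _); apply: eq_bigr => i _; apply: eq_bigr => j _; rewrite !mxE.
exact: du.
Qed.

End SecondOrder.

(** * Matrix identities behind the tensor calculus *)

Section MatrixTranspose.
Context {R : comPzRingType} {n : nat}.
Implicit Types A B : 'M[R]_n.

Lemma entryD p q (A B : 'M[R]_(p, q)) i j : (A + B) i j = A i j + B i j.
Proof. by rewrite mxE. Qed.

Lemma entryN p q (A : 'M[R]_(p, q)) i j : (- A) i j = - A i j.
Proof. by rewrite mxE. Qed.

Lemma tr_mxD A B : (A + B)^T = A^T + B^T. Proof. exact: linearD. Qed.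

Lemma tr_mxB A B : (A - B)^T = A^T - B^T. Proof. exact: linearB. Qed.

Lemma tr_mxN A : (- A)^T = - A^T. Proof. exact: linearN. Qed.

End MatrixTranspose.

Ltac mx_expand := rewrite ?(tr_mxD, tr_mxB, tr_mxN, trmx_mul, trmxK)
   ?(mulmxDl, mulmxDr, mulmxBl, mulmxBr, mulNmx, mulmxN, mulmxA).

(** Meant for identities of the free noncommutative algebra with transposition: after distribution
    the monomials become opaque matrices, and the remaining linear identity is checked entrywise. *)
Ltac mx_abelian := mx_expand;
  repeat match goal with |- context [?A *m ?B] =>
    let X := fresh "X" in set X := A *m B; move: X => X end;
  repeat match goal with |- context [trmx ?A] =>
    let X := fresh "X" in set X := trmx A; move: X => X end;
  apply/matrixP => ? ?; rewrite !mxE; ring.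

Section MatrixIdentities.
Context {R : comPzRingType} {n : nat}.
Implicit Types A B G J X Y : 'M[R]_n.

(** With [A], [B] for Gam_i, Gam_j and [X], [Y] for d_i Gam_j, d_j Gam_i, the hypothesis is d_i d_j
    g = d_j d_i g after metric compatibility has been substituted twice. *)
Lemma skew_curvature A B X Y G :
  X *m G + B *m (A *m G + G *m A^T) + ((A *m G + G *m A^T) *m B^T + G *m X^T)
  = Y *m G + A *m (B *m G + G *m B^T) + ((B *m G + G *m B^T) *m A^T + G *m Y^T) ->
  (X - Y + B *m A - A *m B) *m G + G *m (X - Y + B *m A - A *m B)^T = 0.
Proof.
move/eqP; rewrite -subr_eq0 => /eqP <-.
mx_abelian.
Qed.

(** [Dab] stands for d_a Gam_b and [Sab_c] for d_a d_b Gam_c, with one name for both orders of a and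
    b. The terms cubic in Gam cancel by the Jacobi identity. *)
Lemma second_bianchi_algebra Am Ai Aj Dmi Dim Dmj Djm Dij Dji Smi_j Smj_i Sij_m
    (Fij := Dij - Dji + Aj *m Ai - Ai *m Aj)
    (Fjm := Djm - Dmj + Am *m Aj - Aj *m Am)
    (Fmi := Dmi - Dim + Ai *m Am - Am *m Ai : 'M[R]_n) :
  (Smi_j - Smj_i + (Dmj *m Ai + Aj *m Dmi) - (Dmi *m Aj + Ai *m Dmj)
    - (Am *m Fij - Fij *m Am)) +
  (Sij_m - Smi_j + (Dim *m Aj + Am *m Dij) - (Dij *m Am + Aj *m Dim)
    - (Ai *m Fjm - Fjm *m Ai)) +
  (Smj_i - Sij_m + (Dji *m Am + Ai *m Djm) - (Djm *m Ai + Am *m Dji)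
    - (Aj *m Fmi - Fmi *m Aj)) = 0.
Proof. rewrite /Fij /Fjm /Fmi; mx_abelian. Qed.

(** The first two hypotheses are the gauge law for i and l; the last two are its derivatives in
    directions l and i. They share [Jli] because mixed derivatives of J commute. *)
Lemma gauge_curvature_algebra Ai Al Bi Bl J Ji Jl Jli X X' Y Y' :
  Ai *m J = Ji + J *m Bi -> Al *m J = Jl + J *m Bl ->
  X *m J + Ai *m Jl = Jli + (Jl *m Bi + J *m Y) ->
  X' *m J + Al *m Ji = Jli + (Ji *m Bl + J *m Y') ->
  (X - X' + Ai *m Al - Al *m Ai) *m J = J *m (Y - Y' + Bi *m Bl - Bl *m Bi) :> 'M[R]_n.
Proof.
move=> HAi HAl /(canRL (addrK _)) HX /(canRL (addrK _)) HX'.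
rewrite !(mulmxDl, mulNmx) HX HX' -!mulmxA HAi HAl !mulmxDr !mulmxA HAi HAl.
mx_abelian.
Qed.

(** [A] is F_ij, [P] its derivative d_m F_ij, [B] is Gam_m, and [S], [T] are the Christoffel
    corrections for i and j. The third hypothesis is the derivative of the skewness of F_ij. *)
Lemma covariant_skew_algebra P A B S T G :
  S *m G + G *m S^T = 0 -> T *m G + G *m T^T = 0 ->
  P *m G + A *m (B *m G + G *m B^T) + ((B *m G + G *m B^T) *m A^T + G *m P^T) = 0 ->
  A *m G + G *m A^T = 0 ->
  (P - (B *m A - A *m B) - T - S) *m G + G *m (P - (B *m A - A *m B) - T - S)^T
  = 0 :> 'M[R]_n.
Proof.
move=> S0 T0 P0 A0.
have B1 : B *m (A *m G + G *m A^T) = 0 by rewrite A0 mulmx0.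
have B2 : (A *m G + G *m A^T) *m B^T = 0 by rewrite A0 mul0mx.
(* Zero is rewritten as the combination of the hypotheses that expands to the left-hand side. *)
rewrite -[RHS]addr0 -{1}P0 -{1}oppr0 -{1}S0 -[X in _ = _ + X]addr0 -{1}oppr0 -{1}T0.
rewrite -[RHS]addr0 -{1}oppr0 -{1}B1 -[RHS]addr0 -{1}oppr0 -{1}B2.
mx_abelian.
Qed.

(** The factor in front of [Q] is d_m of the inverse metric [H]; cyclicity of the trace moves [A^T]
    to the other side. *)
Lemma trace_covariant_algebra P Q A H :
  \tr ((- H *m A - A^T *m H) *m Q + H *m P) =
  \tr (H *m (P - A *m Q - Q *m A^T)) :> R.
Proof.
have -> : H *m (P - A *m Q - Q *m A^T) = H *m P - H *m A *m Q - H *m Q *m A^T.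
  by rewrite !mulmxBr !mulmxA.
have -> : (- H *m A - A^T *m H) *m Q + H *m P =
    H *m P - H *m A *m Q - A^T *m (H *m Q).
  by rewrite mulmxBl !mulNmx mulmxA addrC addrA.
by rewrite mxtraceD [RHS]mxtraceD !raddfN/= (mxtrace_mulC A^T).
Qed.

Lemma skew_trace_product (H N G : 'M[R]_n) j k : H^T = H -> G *m H = 1%:M ->
  H *m G = 1%:M -> N *m G + G *m N^T = 0 -> (H *m N) j k = - (H *m N) k j.
Proof.
move=> Hs GH HG /(canRL (addrK _)) NG; rewrite sub0r in NG.
have E : N *m (G *m H) = - (G *m N^T *m H) by rewrite mulmxA NG mulNmx.
have E2 : H *m N = - (H *m N)^T.
  rewrite trmx_mul Hs -{1}[N]mulmx1 -GH E mulmxN !mulmxA HG mul1mx.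
  by [].
by rewrite {1}E2 !mxE.
Qed.

(** Entry (l, k) of [N m i j] stands for nabla_m R^k_lij. The second Bianchi identity splits the
    contracted derivative into two divergences, and antisymmetry of the curvature in l, k once the
    metric has adjusted the indices makes them equal: hence the factor 2. *)
Lemma contracted_bianchi_algebra (N : 'I_n -> 'I_n -> 'I_n -> 'M[R]_n) (H G : 'M[R]_n) m :
  H^T = H -> G *m H = 1%:M -> H *m G = 1%:M ->
  (forall k i j, N k j i = - N k i j) ->
  (forall k i j, N k i j + N i j k + N j k i = 0) ->
  (forall k i j, N k i j *m G + G *m (N k i j)^T = 0) ->
  \sum_l \sum_j H l j * \sum_k N m k j l k =
  (\sum_l \sum_k H l k * \sum_p N l p m k p) *+ 2.
Proof.
move=> Hs GH HG Na Nc Ng.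
have HE l j : H l j = H j l by rewrite -{1}Hs mxE.
have cyc l j k : N m k j l k = - N k j m l k + N j k m l k.
  have := congr1 (fun M : 'M[R]_n => M l k) (Nc m k j).
  rewrite (Na j k m) !mxE => /eqP; rewrite -addrA addr_eq0 => /eqP ->.
  by rewrite opprD opprK.
have flip : \sum_l \sum_j H l j * \sum_k - N k j m l k =
    \sum_l \sum_j H l j * \sum_k N j k m l k.
  transitivity (\sum_j \sum_k - (H *m N k j m) j k).
    rewrite exchange_big; apply: eq_bigr => j _.
    under eq_bigr do rewrite mulr_sumr.
    rewrite exchange_big; apply: eq_bigr => k _; rewrite mxE -sumrN.
    by apply: eq_bigr => l _; rewrite HE mulrN.
  transitivity (\sum_j \sum_k (H *m N k j m) k j).
    apply: eq_bigr => j _; apply: eq_bigr => k _.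
    by rewrite (skew_trace_product j k Hs GH HG (Ng k j m)) opprK.
  rewrite exchange_big/=; under eq_bigr => k _ do under eq_bigr => j _ do rewrite mxE.
  rewrite [RHS]exchange_big/=; apply: eq_bigr => k _.
  rewrite exchange_big/=; apply: eq_bigr => l _.
  by rewrite mulr_sumr; apply: eq_bigr => j _; rewrite HE.
transitivity (\sum_l \sum_j H l j * \sum_k - N k j m l k +
    \sum_l \sum_j H l j * \sum_k N j k m l k).
  rewrite -big_split/=; apply: eq_bigr => l _.
  rewrite -big_split/=; apply: eq_bigr => j _.
  rewrite -mulrDr -big_split/=; congr (_ * _).
  by apply: eq_bigr => k _; exact: cyc.
rewrite flip mulr2n; congr (_ + _).
all: rewrite exchange_big/=; apply: eq_bigr => j _; apply: eq_bigr => l _.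
all: by rewrite HE.
Qed.

End MatrixIdentities.

(** With its index lowered, the difference of the two connections is symmetric in the first two
    indices and antisymmetric in the last two. Alternating these exchanges three times returns to
    the start with the opposite sign. *)
Lemma torsion_free_metric_unique (R : realFieldType) n (A B : 'I_n -> 'M[R]_n) (G : 'M[R]_n) :
  G^T = G -> G \in unitmx ->
  (forall i j k, A i j k = A j i k) -> (forall i j k, B i j k = B j i k) ->
  (forall i, A i *m G + G *m (A i)^T = B i *m G + G *m (B i)^T) ->
  forall i, A i = B i.
Proof.
move=> Gs Gu As Bs AB i.
pose c i j l := ((A i - B i) *m G) j l.
have c1 i' j l : c i' j l = c j i' l.
  by rewrite /c !mxE; apply: eq_bigr => k _; rewrite !mxE As Bs.
have c2 i' j l : c i' j l = - c i' l j.
  apply/eqP; rewrite -addr_eq0; apply/eqP.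
  have : (A i' - B i') *m G + ((A i' - B i') *m G)^T = 0.
    rewrite trmx_mul Gs mulmxBl tr_mxB mulmxBr addrACA AB -opprD.
    exact: subrr.
  by move/matrixP => /(_ j l); rewrite [LHS]mxE [X in _ + X]mxE [RHS]mxE.
have c0 j l : c i j l = 0.
  have : c i j l = - c i j l.
    by rewrite {1}c1 c2 c1 c2 opprK c1 c2.
  by move/eqP; rewrite -addr_eq0 -mulr2n mulrn_eq0/= => /eqP.
have : (A i - B i) *m G = 0 by apply/matrixP => j l; rewrite [RHS]mxE; exact: c0.
move/(congr1 (mulmx^~ (invmx G))); rewrite /= mulmxK// mul0mx => /eqP.
by rewrite subr_eq0 => /eqP.
Qed.

(** With [P] for dJ and [A] compatible with [G], the left side is the derivative of J G J^T; the
    right side is compatibility of that metric with the transformed connection (dJ + J A) J^-1. *)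
Lemma gauge_metric_algebra (R : comUnitRingType) n (J P A G : 'M[R]_n) :
  J \in unitmx ->
  (P *m G + J *m (A *m G + G *m A^T)) *m J^T + J *m G *m P^T =
  (P + J *m A) *m invmx J *m (J *m G *m J^T)
  + J *m G *m J^T *m ((P + J *m A) *m invmx J)^T.
Proof.
move=> Ju; have Jtu : J^T \in unitmx by rewrite unitmx_tr.
have -> : (P + J *m A) *m invmx J *m (J *m G *m J^T) = (P + J *m A) *m G *m J^T.
  by rewrite !mulmxA mulmxKV.
have -> : J *m G *m J^T *m ((P + J *m A) *m invmx J)^T = J *m G *m (P + J *m A)^T.
  by rewrite trmx_mul trmx_inv mulmxA mulmxK.
mx_abelian.
Qed.

(** * Curvature in one chart *)

(* Locked: a failing unification would otherwise unfold derivatives down to limits. *)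
HB.lock Definition partial_mx (R : realType) (n p q : nat) (i : 'I_n)
    (F : 'rV[R]_n -> 'M[R]_(p, q)) (x : 'rV[R]_n) : 'M[R]_(p, q) :=
  \matrix_(a, b) partial i (fun y => F y a b) x.

(* Rows carry the lower index l and columns the upper index k of Gamma^k_il. With
   Gam_i this matrix, metric compatibility reads d_i g = Gam_i g + g Gam_i^T, and entry
   (l, k) of F_ij = d_i Gam_j - d_j Gam_i + Gam_j Gam_i - Gam_i Gam_j is R^k_lij. *)
HB.lock Definition connection_mx (R : realType) (n : nat) (g : 'rV[R]_n -> 'M[R]_n)
    (i : 'I_n) (x : 'rV[R]_n) : 'M[R]_n :=
  \matrix_(l, k) christoffel g k i l x.

Lemma connection_mxE (R : realType) n (g : 'rV[R]_n -> 'M[R]_n) i x l k :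
  connection_mx g i x l k = christoffel g k i l x.
Proof. by rewrite unlock mxE. Qed.

Lemma connection_mx_entry (R : realType) n (g : 'rV[R]_n -> 'M[R]_n) i l k :
  (fun y => connection_mx g i y l k) = christoffel g k i l.
Proof. by apply/funext => y; rewrite connection_mxE. Qed.

Section MatrixCalculus.
Context {R : realType} {n : nat}.
Local Notation V := 'rV[R]_n.

Lemma partial_mxE p q i (F : V -> 'M[R]_(p, q)) x a b :
  partial_mx i F x a b = partial i (fun y => F y a b) x.
Proof. by rewrite unlock mxE. Qed.

Lemma partial_mx_entry p q i (F : V -> 'M[R]_(p, q)) a b :
  (fun y => partial_mx i F y a b) = partial i (fun y => F y a b).
Proof. by apply/funext => y; rewrite partial_mxE. Qed.

Definition derivable_mx p q (i : 'I_n) (F : V -> 'M[R]_(p, q)) (x : V) :=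
  forall a b, derivable (fun y => F y a b) x (delta_mx 0 i).

Definition smooth_mx p q (D : set V) (F : V -> 'M[R]_(p, q)) :=
  forall a b, smooth_on D (fun y => F y a b).

Lemma smooth_derivable_mx p q D (F : V -> 'M[R]_(p, q)) i x :
  smooth_mx D F -> D x -> derivable_mx i F x.
Proof. by move=> FD Dx a b; exact: smooth_derivable (FD a b) Dx. Qed.

Lemma partial_mxD p q i (F H : V -> 'M[R]_(p, q)) x :
  derivable_mx i F x -> derivable_mx i H x ->
  partial_mx i (fun y => F y + H y) x = partial_mx i F x + partial_mx i H x.
Proof.
move=> dF dH; apply/matrixP => a b; rewrite !(partial_mxE, entryD, entryN) /partial.
under eq_fun do rewrite mxE.
exact: deriveD (dF a b) (dH a b).
Qed.

Lemma partial_mxB p q i (F H : V -> 'M[R]_(p, q)) x :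
  derivable_mx i F x -> derivable_mx i H x ->
  partial_mx i (fun y => F y - H y) x = partial_mx i F x - partial_mx i H x.
Proof.
move=> dF dH; apply/matrixP => a b; rewrite !(partial_mxE, entryD, entryN) /partial.
under eq_fun do rewrite !mxE.
exact: deriveB (dF a b) (dH a b).
Qed.

Lemma partialM (f h : V -> R) i x : derivable f x (delta_mx 0 i) ->
  derivable h x (delta_mx 0 i) ->
  partial i (fun y => f y * h y) x = partial i f x * h x + f x * partial i h x.
Proof.
move=> df dh; rewrite /partial (deriveM df dh) addrC.
by congr (_ + _); rewrite [LHS]mulrC.
Qed.

Lemma partialN (f : V -> R) i x : derivable f x (delta_mx 0 i) ->
  partial i (fun y => - f y) x = - partial i f x.
Proof. exact: deriveN. Qed.

Lemma partial_sum (I : finType) (f : I -> V -> R) i x :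
  (forall a, derivable (f a) x (delta_mx 0 i)) ->
  partial i (fun y => \sum_a f a y) x = \sum_a partial i (f a) x.
Proof.
move=> df; rewrite /partial; apply: (@derive_val _ _ _ _ _ _ _ _).
have : forall s : seq I, is_derive x (delta_mx 0 i) (fun y => \sum_(a <- s) f a y)
    (\sum_(a <- s) 'D_(delta_mx 0 i) (f a) x).
  elim=> [|a s IH].
    under eq_fun do rewrite big_nil.
    by rewrite big_nil; exact: is_derive_cst.
  under eq_fun do rewrite big_cons.
  rewrite big_cons; exact: (is_deriveD (derivableP (df a)) IH).
exact.
Qed.

Lemma derivable_sum_fin (I : finType) (f : I -> V -> R) i x :
  (forall a, derivable (f a) x (delta_mx 0 i)) ->
  derivable (fun y => \sum_a f a y) x (delta_mx 0 i).
Proof.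
move=> df; suff : forall s : seq I,
    derivable (fun y => \sum_(a <- s) f a y) x (delta_mx 0 i) by exact.
elim=> [|a s IH].
  by under eq_fun do rewrite big_nil; exact: derivable_cst.
under eq_fun do rewrite big_cons.
exact: derivableD (df a) IH.
Qed.

Lemma derivable_mxM p q r i (F : V -> 'M[R]_(p, q)) (H : V -> 'M[R]_(q, r)) x :
  derivable_mx i F x -> derivable_mx i H x ->
  derivable_mx i (fun y => F y *m H y) x.
Proof.
move=> dF dH a b; under eq_fun do rewrite mxE.
by apply: derivable_sum_fin => c; exact: derivableM.
Qed.

Lemma partial_mxM p q r i (F : V -> 'M[R]_(p, q)) (H : V -> 'M[R]_(q, r)) x :
  derivable_mx i F x -> derivable_mx i H x ->
  partial_mx i (fun y => F y *m H y) x =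
  partial_mx i F x *m H x + F x *m partial_mx i H x.
Proof.
move=> dF dH; apply/matrixP => a b; rewrite partial_mxE entryD !mxE.
under eq_fun do rewrite mxE.
rewrite partial_sum; last by move=> c; exact: derivableM.
rewrite -big_split/=; apply: eq_bigr => c _; rewrite !partial_mxE.
exact: partialM.
Qed.

Lemma derivable_mxD p q i (F H : V -> 'M[R]_(p, q)) x :
  derivable_mx i F x -> derivable_mx i H x ->
  derivable_mx i (fun y => F y + H y) x.
Proof.
move=> dF dH a b; under eq_fun do rewrite mxE.
exact: derivableD (dF a b) (dH a b).
Qed.

Lemma derivable_mxB p q i (F H : V -> 'M[R]_(p, q)) x :
  derivable_mx i F x -> derivable_mx i H x ->
  derivable_mx i (fun y => F y - H y) x.
Proof.
move=> dF dH a b; under eq_fun do rewrite !mxE.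
exact: derivableB (dF a b) (dH a b).
Qed.

Lemma partial_cst i (a : R) (x : V) : partial i (fun=> a : R) x = 0.
Proof. exact: derive_cst. Qed.

Lemma partial_mx_tr p q i (F : V -> 'M[R]_(p, q)) x :
  partial_mx i (fun y => (F y)^T) x = (partial_mx i F x)^T.
Proof.
by apply/matrixP => a b; rewrite mxE !partial_mxE; under eq_fun do rewrite mxE.
Qed.

Lemma derivable_mx_tr p q i (F : V -> 'M[R]_(p, q)) x :
  derivable_mx i F x -> derivable_mx i (fun y => (F y)^T) x.
Proof. by move=> dF a b; under eq_fun do rewrite mxE; exact: dF. Qed.

Lemma partial_near (f h : V -> R) i x :
  (\near x, f x = h x) -> partial i f x = partial i h x.
Proof. exact: near_eq_derive. Qed.

Lemma partial_mx_open p q (D : set V) (F H : V -> 'M[R]_(p, q)) i x :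
  open D -> D x -> (forall y, D y -> F y = H y) -> partial_mx i F x = partial_mx i H x.
Proof.
move=> oD Dx FH; apply/matrixP => a b; rewrite !partial_mxE; apply: partial_near.
have nD := open_nbhs_nbhs (conj oD Dx).
by apply: filterS nD => y /FH ->.
Qed.

Lemma smooth_partial_mx p q D (F : V -> 'M[R]_(p, q)) i :
  smooth_mx D F -> smooth_mx D (partial_mx i F).
Proof.
move=> FD a b; rewrite partial_mx_entry; exact: smooth_partial (FD a b).
Qed.

Lemma partial_mxC p q D (F : V -> 'M[R]_(p, q)) i j x : open D -> D x ->
  smooth_mx D F ->
  partial_mx i (partial_mx j F) x = partial_mx j (partial_mx i F) x.
Proof.
move=> oD Dx FD; apply/matrixP => a b; rewrite [LHS]partial_mxE [RHS]partial_mxE !partial_mx_entry.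
exact: partialC oD Dx (FD a b).
Qed.

Section SmoothMx.
Variables (D : set V) (oD : open D).

Lemma smooth_mxM p q r (F : V -> 'M[R]_(p, q)) (H : V -> 'M[R]_(q, r)) :
  smooth_mx D F -> smooth_mx D H -> smooth_mx D (fun y => F y *m H y).
Proof.
move=> FD HD a b; under eq_fun do rewrite mxE.
by apply: smooth_sum => // c _; exact: smoothM.
Qed.

Lemma smooth_mxD p q (F H : V -> 'M[R]_(p, q)) :
  smooth_mx D F -> smooth_mx D H -> smooth_mx D (fun y => F y + H y).
Proof. by move=> FD HD a b; under eq_fun do rewrite mxE; exact: smoothD. Qed.

Lemma smooth_mxB p q (F H : V -> 'M[R]_(p, q)) :
  smooth_mx D F -> smooth_mx D H -> smooth_mx D (fun y => F y - H y).
Proof. by move=> FD HD a b; under eq_fun do rewrite !mxE; exact: smoothB. Qed.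

End SmoothMx.
End MatrixCalculus.


Section LocalCurvature.
Context {R : realType} {n : nat}.
Local Notation V := 'rV[R]_n.
Variables (D : set V) (g : V -> 'M[R]_n).
Hypotheses (oD : open D) (gD : smooth_mx D g).
Hypothesis g_sym : forall x, D x -> (g x)^T = g x.
Hypothesis g_unit : forall x, D x -> g x \in unitmx.

Definition curvature_mx (i j : 'I_n) (x : V) : 'M[R]_n :=
  partial_mx i (connection_mx g j) x - partial_mx j (connection_mx g i) x
  + connection_mx g j x *m connection_mx g i x
  - connection_mx g i x *m connection_mx g j x.

Local Notation Gam := (connection_mx g).
Local Notation F := curvature_mx.

Let gC l x i j : D x -> partial l (fun y => g y i j) x = partial l (fun y => g y j i) x.
Proof.
move=> Dx; apply: partial_near; apply: filterS (open_nbhs_nbhs (conj oD Dx)) => y Dy.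
by rewrite -{1}(g_sym Dy) mxE.
Qed.

Lemma christoffelC k i j x : D x -> christoffel g k i j x = christoffel g k j i x.
Proof.
move=> Dx; congr (_ * _); apply: eq_bigr => l _; congr (_ * _).
by rewrite (gC l i j Dx) [X in X - _]addrC.
Qed.

Lemma smooth_christoffel k i j : smooth_on D (christoffel g k i j).
Proof.
apply: smoothM => //; first exact: smooth_cst.
apply: smooth_sum => // l _; apply: smoothM => //; first exact: smooth_invmx.
apply: smoothB => //; first apply: smoothD => //; exact: smooth_partial (gD _ _).
Qed.

Lemma smooth_connection i : smooth_mx D (Gam i).
Proof.
by move=> a b; rewrite connection_mx_entry; exact: smooth_christoffel.
Qed.

Lemma smooth_curvature i j : smooth_mx D (F i j).
Proof.
have sG := smooth_connection; have sM k l := smooth_mxM oD (sG k) (sG l).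
have sP k l := smooth_partial_mx k (sG l).
exact: (smooth_mxB oD (smooth_mxD oD (smooth_mxB oD (sP i j) (sP j i)) (sM j i)) (sM i j)).
Qed.

Lemma lower_christoffel i j l x : D x ->
  \sum_k christoffel g k i j x * g x k l =
  2^-1 * (partial i (fun y => g y j l) x + partial j (fun y => g y i l) x
     - partial l (fun y => g y i j) x).
Proof.
move=> Dx; rewrite /christoffel.
pose c m := partial i (fun y => g y j m) x + partial j (fun y => g y i m) x
     - partial m (fun y => g y i j) x.
transitivity (2^-1 * \sum_m (\sum_k g x l k * invmx (g x) k m) * c m).
  under eq_bigr do rewrite -mulrA mulr_suml.
  rewrite -mulr_sumr exchange_big/=; congr (_ * _); apply: eq_bigr => m _.
  rewrite mulr_suml; apply: eq_bigr => k _.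
  have -> : g x k l = g x l k by rewrite -{1}(g_sym Dx) mxE.
  by rewrite -/(c m); move: (c m) (g x l k) (invmx _ _ _) => u v w; ring.
have gV m : \sum_k g x l k * invmx (g x) k m = (l == m)%:R.
  by have := mulmxV (g_unit Dx); move/matrixP => /(_ l m); rewrite !mxE.
congr (_ * _); rewrite (bigD1 l)//= gV eqxx mul1r [X in _ + X]big1 ?addr0//.
by move=> m ml; rewrite gV eq_sym (negbTE ml) mul0r.
Qed.

Lemma metric_compatibility i x : D x ->
  partial_mx i g x = Gam i x *m g x + g x *m (Gam i x)^T.
Proof.
move=> Dx; apply/matrixP => j l; rewrite partial_mxE entryD.
have -> : (Gam i x *m g x) j l = \sum_k christoffel g k i j x * g x k l.
  by rewrite mxE; apply: eq_bigr => k _; rewrite connection_mxE.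
have -> : (g x *m (Gam i x)^T) j l = \sum_k christoffel g k i l x * g x k j.
  rewrite mxE; apply: eq_bigr => k _; rewrite [X in _ * X]mxE connection_mxE mulrC.
  by congr (_ * _); rewrite -{1}(g_sym Dx) mxE.
rewrite !lower_christoffel// (gC i l j Dx).
move: (partial _ _ _) (partial _ _ _) (partial _ _ _) => a b c; lra.
Qed.

Lemma curvature_mx_entry i j x l k : F i j x l k =
  partial i (christoffel g k j l) x - partial j (christoffel g k i l) x
  + (Gam j x *m Gam i x) l k - (Gam i x *m Gam j x) l k.
Proof.
have E a b : partial_mx a (Gam b) x l k = partial a (christoffel g k b l) x.
  by rewrite partial_mxE connection_mx_entry.
rewrite -!E /F; move: (partial_mx _ _ _) (partial_mx _ _ _) (_ *m _) (_ *m _).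
by move=> A B M N; rewrite !entryD !entryN.
Qed.

Lemma nabla_coord_vect l j k :
  nabla_vect g (coord_vect l) j k = christoffel g k j l.
Proof.
apply/funext => x; rewrite /nabla_vect /coord_vect partial_cst add0r.
rewrite (bigD1 l)//= eqxx mulr1 big1 ?addr0// => m /negbTE ->.
by rewrite mulr0.
Qed.

(** The correction for the lower index of nabla_j X^k is symmetric in i and j because the connection
    is torsion free, so it disappears on antisymmetrization. *)
Lemma riemannE k l i j x : D x -> riemann g k l i j x = F i j x l k.
Proof.
move=> Dx; rewrite curvature_mx_entry.
have E a b : nabla2_vect g (coord_vect l) a b k x =
    partial a (christoffel g k b l) x + (Gam b x *m Gam a x) l k
    - \sum_m christoffel g m a b x * christoffel g k m l x.
  rewrite /nabla2_vect nabla_coord_vect; congr (_ + _ - _).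
    rewrite mxE; apply: eq_bigr => m _.
    by rewrite nabla_coord_vect mulrC !connection_mxE.
  by apply: eq_bigr => m _; rewrite nabla_coord_vect.
rewrite /riemann !E.
have -> : \sum_m christoffel g m j i x * christoffel g k m l x =
    \sum_m christoffel g m i j x * christoffel g k m l x.
  by apply: eq_bigr => m _; rewrite christoffelC.
move: (\sum_m _) (partial _ _ _) (partial _ _ _) (fun_of_matrix _ _ _) (fun_of_matrix _ _ _).
move=> u a b c d; ring.
Qed.

Lemma ricci_locE i j x : D x -> ricci_loc g x i j = \sum_k F k j x i k.
Proof. by move=> Dx; rewrite mxE; apply: eq_bigr => k _; rewrite riemannE. Qed.

Lemma smooth_ricci_loc : smooth_mx D (ricci_loc g).
Proof.
move=> i j; apply: (smooth_ext oD (f := fun x => \sum_k F k j x i k)).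
  by move=> x Dx; rewrite ricci_locE.
by apply: smooth_sum => // k _; exact: smooth_curvature.
Qed.

Lemma smooth_scalar_loc : smooth_on D (scalar_loc g).
Proof.
apply: smooth_sum => // i _; apply: smooth_sum => // j _; apply: smoothM => //.
  exact: smooth_invmx.
exact: smooth_ricci_loc.
Qed.

Lemma curvature_mxC i j x : F j i x = - F i j x.
Proof.
rewrite /F; move: (partial_mx _ _ _) (partial_mx _ _ _) (_ *m _) (_ *m _).
by move=> A B M N; apply/matrixP => a b; rewrite !mxE; ring.
Qed.

Let dG i x : D x -> derivable_mx i g x.
Proof. exact: smooth_derivable_mx gD. Qed.

Let dGam i j x : D x -> derivable_mx i (Gam j) x.
Proof. exact: smooth_derivable_mx (smooth_connection j). Qed.

Lemma curvature_mx_skew i j x : D x -> F i j x *m g x + g x *m (F i j x)^T = 0.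
Proof.
move=> Dx; apply: skew_curvature.
have P a b : partial_mx a (partial_mx b g) x =
   partial_mx a (Gam b) x *m g x + Gam b x *m partial_mx a g x +
   (partial_mx a g x *m (Gam b x)^T + g x *m (partial_mx a (Gam b) x)^T).
  rewrite (partial_mx_open a oD Dx (metric_compatibility b)).
  have dg := @dG a x Dx; have dGb := @dGam a b x Dx; have dGt := derivable_mx_tr dGb.
  rewrite (partial_mxD (derivable_mxM dGb dg) (derivable_mxM dg dGt)).
  by rewrite (partial_mxM dGb dg) (partial_mxM dg dGt) partial_mx_tr.
by have := partial_mxC i j oD Dx gD; rewrite !P !metric_compatibility.
Qed.

Lemma partial_curvature_mx m i j x : D x -> partial_mx m (F i j) x =
  partial_mx m (partial_mx i (Gam j)) x - partial_mx m (partial_mx j (Gam i)) x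
  + (partial_mx m (Gam j) x *m Gam i x + Gam j x *m partial_mx m (Gam i) x)
  - (partial_mx m (Gam i) x *m Gam j x + Gam i x *m partial_mx m (Gam j) x).
Proof.
move=> Dx; have dP a b : derivable_mx m (partial_mx a (Gam b)) x.
  exact: smooth_derivable_mx (smooth_partial_mx a (smooth_connection b)) Dx.
have dM a b := derivable_mxM (@dGam m a x Dx) (@dGam m b x Dx).
have dB a b c d := derivable_mxB (dP a b) (dP c d).
rewrite /F (partial_mxB (derivable_mxD (dB i j j i) (dM j i)) (dM i j)).
rewrite (partial_mxD (dB i j j i) (dM j i)) (partial_mxB (dP i j) (dP j i)).
by rewrite !(partial_mxM (@dGam m _ x Dx) (@dGam m _ x Dx)).
Qed.

(** The indices i, j are treated as form indices, without Christoffel corrections, as in the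
    exterior covariant derivative of F; [covariant_bianchi] adds those corrections. *)
Lemma second_bianchi m i j x : D x ->
  (partial_mx m (F i j) x - (Gam m x *m F i j x - F i j x *m Gam m x)) +
  (partial_mx i (F j m) x - (Gam i x *m F j m x - F j m x *m Gam i x)) +
  (partial_mx j (F m i) x - (Gam j x *m F m i x - F m i x *m Gam j x)) = 0.
Proof.
move=> Dx; rewrite !partial_curvature_mx//.
have C a b c := partial_mxC a b oD Dx (smooth_connection c).
rewrite (C i m j) (C j m i) (C j i m); pose P a b := partial_mx a (Gam b) x; pose S a b c := partial_mx a (partial_mx b (Gam c)) x.
exact (second_bianchi_algebra (Gam m x) (Gam i x) (Gam j x) (P m i) (P i m)
  (P m j) (P j m) (P i j) (P j i) (S m i j) (S m j i) (S i j m)).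
Qed.

End LocalCurvature.

(** * Bianchi identities, symmetry of Ric and the differential of the scalar curvature *)

Section ContractedBianchi.
Context {R : realType} {n : nat}.
Local Notation V := 'rV[R]_n.
Variables (D : set V) (g : V -> 'M[R]_n).
Hypotheses (oD : open D) (gD : smooth_mx D g).
Hypothesis g_sym : forall x, D x -> (g x)^T = g x.
Hypothesis g_unit : forall x, D x -> g x \in unitmx.
Local Notation Gam := (connection_mx g).
Local Notation F := (curvature_mx g).

(** All terms cancel in pairs by the symmetry of the Christoffel symbols in their lower indices. *)
Lemma first_bianchi i j l k x : D x -> F i j x l k + F j l x i k + F l i x j k = 0.
Proof.
move=> Dx; rewrite !curvature_mx_entry.
have p a b c : partial a (christoffel g k b c) x = partial a (christoffel g k c b) x.
  apply: partial_near; apply: filterS (open_nbhs_nbhs (conj oD Dx)) => y Dy.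
  exact: (christoffelC oD g_sym).
have q a b c : (Gam a x *m Gam b x) c k = (Gam c x *m Gam b x) a k.
  rewrite !mxE; apply: eq_bigr => m _; rewrite !connection_mxE.
  by rewrite (christoffelC oD g_sym).
rewrite (p i l j) (p j i l) (p l j i) (q j i l) (q l j i) (q i l j).
move: (partial _ _ _) (partial _ _ _) (partial _ _ _).
move: (fun_of_matrix _ _ _) (fun_of_matrix _ _ _) (fun_of_matrix _ _ _).
move=> a b c u v w; ring.
Qed.

(** By skewness, F is minus a conjugate of its transpose, so its trace equals its own negative. *)
Lemma curvature_mx_trace i j x : D x -> \tr (F i j x) = 0.
Proof.
move=> Dx; have := curvature_mx_skew oD gD g_sym g_unit i j Dx.
move: (F i j x) => A /eqP; rewrite addr_eq0 => /eqP E.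
have : \tr A = - \tr A.
  rewrite -{1}(mulmxK (g_unit Dx) A) E mulNmx linearN/= mxtrace_mulC mulmxA.
  by rewrite mulVmx ?g_unit// mul1mx mxtrace_tr.
by move/eqP; rewrite -addr_eq0 -mulr2n mulrn_eq0/= => /eqP.
Qed.

(** Contracting the first Bianchi identity turns the antisymmetric part of Ric into the trace of a
    curvature matrix, which vanishes. *)
Lemma ricci_loc_sym x : D x -> (ricci_loc g x)^T = ricci_loc g x.
Proof.
move=> Dx; apply/matrixP => i j; rewrite mxE !(ricci_locE oD g_sym)//.
apply/eqP; rewrite -subr_eq0 -sumrB; apply/eqP.
transitivity (- \tr (F i j x)); last by rewrite curvature_mx_trace// oppr0.
rewrite /mxtrace -sumrN; apply: eq_bigr => k _; have := first_bianchi k i j k Dx.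
rewrite (curvature_mxC g k j x) entryN addrAC => /eqP; rewrite addr_eq0 => /eqP.
exact.
Qed.

Definition covariant_mx (a : V -> 'M[R]_n) (m : 'I_n) (x : V) : 'M[R]_n :=
  partial_mx m a x - Gam m x *m a x - a x *m (Gam m x)^T.

Lemma nabla_cov2E a m i j x : nabla_cov2 g a m i j x = covariant_mx a m x i j.
Proof.
rewrite /covariant_mx !entryD !entryN partial_mxE /nabla_cov2; congr (_ - _ - _).
  by rewrite mxE; apply: eq_bigr => p _; rewrite connection_mxE.
by rewrite mxE; apply: eq_bigr => p _; rewrite mxE connection_mxE mulrC.
Qed.

(** Entry (l, k) is nabla_m R^k_lij: the commutator corrects for the matrix indices l, k and the two
    sums for i, j. *)
Definition covariant_curvature (m i j : 'I_n) (x : V) : 'M[R]_n :=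
  partial_mx m (F i j) x - (Gam m x *m F i j x - F i j x *m Gam m x)
  - \sum_p christoffel g p m i x *: F p j x
  - \sum_p christoffel g p m j x *: F i p x.

Local Notation N := covariant_curvature.

Lemma covariant_curvatureC m i j x : D x -> N m j i x = - N m i j x.
Proof.
move=> Dx.
have pN : partial_mx m (F j i) x = - partial_mx m (F i j) x.
  apply/matrixP => a b; rewrite entryN !partial_mxE.
  have -> : (fun y => F j i y a b) = fun y => - F i j y a b.
    by apply/funext => y; rewrite curvature_mxC entryN.
  rewrite partialN//.
  exact: smooth_derivable (smooth_curvature oD gD g_unit i j a b) Dx.
rewrite /N pN (curvature_mxC g i j x).
have S1 : \sum_p christoffel g p m j x *: F p i x =
    - \sum_p christoffel g p m j x *: F i p x.
  by rewrite -sumrN; apply: eq_bigr => p _; rewrite (curvature_mxC g i p) scalerN.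
have S2 : \sum_p christoffel g p m i x *: F j p x =
    - \sum_p christoffel g p m i x *: F p j x.
  by rewrite -sumrN; apply: eq_bigr => p _; rewrite (curvature_mxC g p j) scalerN.
rewrite S1 S2 mulmxN mulNmx.
move: (partial_mx _ _ _) (_ *m _) (_ *m _) (\sum_p _) (\sum_p _) => A B C E H.
by apply/matrixP => a b; rewrite !mxE; ring.
Qed.

(** The six Christoffel corrections cancel in pairs, by torsion freeness and the antisymmetry of F
    in its form indices. *)
Lemma covariant_bianchi m i j x : D x -> N m i j x + N i j m x + N j m i x = 0.
Proof.
move=> Dx.
pose K a b c := partial_mx a (F b c) x - (Gam a x *m F b c x - F b c x *m Gam a x).
have E : K m i j + K i j m + K j m i = 0.
  exact: (second_bianchi oD gD g_unit m i j Dx).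
pose T (a b c : 'I_n) := \sum_p christoffel g p a b x *: F p c x.
pose U (a b c : 'I_n) := \sum_p christoffel g p a b x *: F c p x.
have TU a b c : U a b c = - T a b c.
  by rewrite -sumrN; apply: eq_bigr => p _; rewrite (curvature_mxC g p c) scalerN.
have Ts a b c : T a b c = T b a c.
  by apply: eq_bigr => p _; rewrite (christoffelC oD g_sym).
rewrite /N -/(T m i j) -/(T i j m) -/(T j m i) -/(U m j i) -/(U i m j) -/(U j i m).
rewrite !TU (Ts m j i) (Ts i m j) (Ts j i m).
move: (T _ _ _) (T _ _ _) (T _ _ _) => t1 t2 t3.
rewrite -/(K m i j) -/(K i j m) -/(K j m i).
move: (K m i j) (K i j m) (K j m i) E => A B C E.
by rewrite -E; apply/matrixP => a b; rewrite !mxE; ring.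
Qed.

(** The skewness of F is differentiated; since g is parallel, no derivative of g survives. *)
Lemma covariant_curvature_skew m i j x : D x ->
  N m i j x *m g x + g x *m (N m i j x)^T = 0.
Proof.
move=> Dx; have sk a b y (Dy : D y) := curvature_mx_skew oD gD g_sym g_unit a b Dy.
have dF : derivable_mx m (F i j) x.
  exact: smooth_derivable_mx (smooth_curvature oD gD g_unit i j) Dx.
have dg : derivable_mx m g x by exact: smooth_derivable_mx gD Dx.
have dS : partial_mx m (F i j) x *m g x + F i j x *m partial_mx m g x
    + (partial_mx m g x *m (F i j x)^T + g x *m (partial_mx m (F i j) x)^T) = 0.
  have dFt := derivable_mx_tr dF.
  rewrite -partial_mx_tr -(partial_mxM dF dg) -(partial_mxM dg dFt).
  rewrite -(partial_mxD (derivable_mxM dF dg) (derivable_mxM dg dFt)).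
  rewrite (partial_mx_open (H := fun=> 0) m oD Dx); last exact: sk.
  apply/matrixP => a b; rewrite partial_mxE [RHS]mxE.
  by under eq_fun do rewrite mxE; rewrite partial_cst.
have sum_skew (c : 'I_n -> R) (A : 'I_n -> 'M[R]_n) :
    (forall p, A p *m g x + g x *m (A p)^T = 0) ->
    (\sum_p c p *: A p) *m g x + g x *m (\sum_p c p *: A p)^T = 0.
  move=> Ask; rewrite linear_sum/= mulmx_suml mulmx_sumr -big_split/=.
  rewrite big1// => p _; rewrite linearZ/= -scalemxAl -scalemxAr -scalerDr.
  by rewrite Ask scaler0.
rewrite /N; have := sum_skew (fun p => christoffel g p m i x) (fun p => F p j x)
  (fun p => sk p j x Dx).
have := sum_skew (fun p => christoffel g p m j x) (fun p => F i p x)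
  (fun p => sk i p x Dx).
move: (\sum_p _) (\sum_p _) => S T T0 S0.
rewrite (metric_compatibility oD g_sym g_unit m Dx) in dS.
exact: (covariant_skew_algebra T0 S0 dS (sk i j x Dx)).
Qed.

Lemma covariant_ricci m x : D x ->
  forall l j, covariant_mx (ricci_loc g) m x l j = \sum_k N m k j x l k.
Proof.
move=> Dx l j; rewrite /covariant_mx !entryD !entryN partial_mxE.
have -> : partial m (fun y => ricci_loc g y l j) x =
    \sum_k partial_mx m (F k j) x l k.
  rewrite (partial_near (h := fun y => \sum_k F k j y l k)); last first.
    apply: filterS (open_nbhs_nbhs (conj oD Dx)) => y Dy.
    exact: (ricci_locE oD g_sym).
  rewrite partial_sum; last first.
    by move=> k; exact: smooth_derivable (smooth_curvature oD gD g_unit k j l k) Dx.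
  by apply: eq_bigr => k _; rewrite partial_mxE.
have -> : (Gam m x *m ricci_loc g x) l j = \sum_k (Gam m x *m F k j x) l k.
  rewrite mxE; under eq_bigr do rewrite (ricci_locE oD g_sym _ _ Dx) mulr_sumr.
  rewrite exchange_big/=; apply: eq_bigr => k _; rewrite mxE.
  by apply: eq_bigr.
have -> : (ricci_loc g x *m (Gam m x)^T) l j =
    \sum_k (\sum_p christoffel g p m j x *: F k p x) l k.
  rewrite mxE; under eq_bigr do rewrite (ricci_locE oD g_sym _ _ Dx) mulr_suml.
  rewrite exchange_big/=; apply: eq_bigr => k _; rewrite summxE.
  by apply: eq_bigr => p _; rewrite !mxE connection_mxE mulrC.
(* The corrections for the upper and the lower copy of the contracted index k cancel: contraction
   commutes with nabla. *)
have cancel : \sum_k (F k j x *m Gam m x) l k =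
    \sum_k (\sum_p christoffel g p m k x *: F p j x) l k.
  under eq_bigr do rewrite mxE; rewrite exchange_big/=.
  under [RHS]eq_bigr do rewrite summxE.
  rewrite [RHS]exchange_big/= exchange_big/=.
  by apply: eq_bigr => k _; apply: eq_bigr => p _; rewrite !mxE connection_mxE mulrC.
have NE k : N m k j x l k = partial_mx m (F k j) x l k - (Gam m x *m F k j x) l k
    + (F k j x *m Gam m x) l k - (\sum_p christoffel g p m k x *: F p j x) l k
    - (\sum_p christoffel g p m j x *: F k p x) l k.
  rewrite /N; move: (partial_mx _ _ _) (_ *m _) (_ *m _) (\sum_p _) (\sum_p _).
  by move=> P A B S T; rewrite !mxE; ring.
rewrite (eq_bigr _ (fun k _ => NE k)) !sumrB big_split/= sumrB cancel.
by rewrite addrK.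
Qed.

Lemma partial_scalar_loc m x : D x -> partial m (scalar_loc g) x =
  \tr (invmx (g x) *m covariant_mx (ricci_loc g) m x).
Proof.
move=> Dx.
have Hs y : D y -> (invmx (g y))^T = invmx (g y).
  by move=> Dy; rewrite trmx_inv g_sym.
have sI : smooth_mx D (fun y => invmx (g y)) by exact: smooth_invmx.
have sR := smooth_ricci_loc oD gD g_sym g_unit.
have dI : derivable_mx m (fun y => invmx (g y)) x by exact: smooth_derivable_mx sI Dx.
have dR : derivable_mx m (ricci_loc g) x by exact: smooth_derivable_mx sR Dx.
have dg : derivable_mx m g x by exact: smooth_derivable_mx gD Dx.
have E : partial m (scalar_loc g) x =
    \tr (partial_mx m (fun y => invmx (g y) *m ricci_loc g y) x).
  rewrite (partial_near (h := fun y => \sum_i (invmx (g y) *m ricci_loc g y) i i)).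
    rewrite partial_sum; last by move=> i; exact: (derivable_mxM dI dR).
    by apply: eq_bigr => i _; rewrite partial_mxE.
  apply: filterS (open_nbhs_nbhs (conj oD Dx)) => y Dy.
  apply: eq_bigr => i _; rewrite mxE; apply: eq_bigr => j _.
  by congr (_ * _); rewrite -[in RHS](ricci_loc_sym Dy) [RHS]mxE.
(* The derivative of the inverse metric comes from differentiating g^-1 g = 1. *)
have dH : partial_mx m (fun y => invmx (g y)) x =
    - invmx (g x) *m Gam m x - (Gam m x)^T *m invmx (g x).
  have : partial_mx m (fun y => invmx (g y) *m g y) x = 0.
    rewrite (partial_mx_open (H := fun=> 1%:M) m oD Dx).
      apply/matrixP => a b; rewrite partial_mxE [RHS]mxE.
      exact: partial_cst.
    by move=> y Dy; rewrite mulVmx// g_unit.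
  rewrite (partial_mxM dI dg) (metric_compatibility oD g_sym g_unit m Dx).
  move/(congr1 (mulmx^~ (invmx (g x)))); rewrite /= mul0mx mulmxDl mulmxK ?g_unit//.
  rewrite mulmxDr !mulmxA mulVmx ?g_unit// mul1mx mulmxDl mulmxK ?g_unit//.
  by move=> /eqP; rewrite addr_eq0 => /eqP ->; rewrite opprD mulNmx.
rewrite E (partial_mxM dI dR) dH /covariant_mx.
exact: trace_covariant_algebra.
Qed.

Lemma contracted_bianchi m x : D x ->
  (\sum_l \sum_k invmx (g x) l k * covariant_mx (ricci_loc g) l x k m) *+ 2 =
  partial m (scalar_loc g) x.
Proof.
move=> Dx; rewrite partial_scalar_loc//.
have Hs : (invmx (g x))^T = invmx (g x) by rewrite trmx_inv g_sym.
have := @contracted_bianchi_algebra R n (fun a b c => N a b c x) (invmx (g x)) (g x) m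
  Hs (mulmxV (g_unit Dx)) (mulVmx (g_unit Dx)).
move=> /(_ (fun k i j => covariant_curvatureC k i j Dx)).
move=> /(_ (fun k i j => covariant_bianchi k i j Dx)).
move=> /(_ (fun k i j => covariant_curvature_skew k i j Dx)) E.
transitivity ((\sum_l \sum_k invmx (g x) l k * \sum_p N l p m x k p) *+ 2).
  congr (_ *+ 2); apply: eq_bigr => l _; apply: eq_bigr => k _.
  by rewrite covariant_ricci.
rewrite -E /mxtrace; under [RHS]eq_bigr do rewrite mxE.
rewrite [RHS]exchange_big/=; apply: eq_bigr => l _; apply: eq_bigr => j _.
by rewrite covariant_ricci// -[in RHS]Hs mxE.
Qed.

Lemma trace_covariant_ricci m x : D x ->
  \sum_l \sum_k invmx (g x) l k * covariant_mx (ricci_loc g) m x l k =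
  partial m (scalar_loc g) x.
Proof.
move=> Dx; rewrite partial_scalar_loc// /mxtrace.
have Hs : (invmx (g x))^T = invmx (g x) by rewrite trmx_inv g_sym.
under [RHS]eq_bigr do rewrite mxE.
rewrite [RHS]exchange_big/=; apply: eq_bigr => l _; apply: eq_bigr => j _.
by congr (_ * _); rewrite -[in RHS]Hs [RHS]mxE.
Qed.

Lemma covariant_ricci_sym m x : D x ->
  (covariant_mx (ricci_loc g) m x)^T = covariant_mx (ricci_loc g) m x.
Proof.
move=> Dx; rewrite /covariant_mx !linearB/= !trmx_mul trmxK ricci_loc_sym//.
rewrite -partial_mx_tr (partial_mx_open (H := ricci_loc g) m oD Dx).
  by rewrite addrAC.
exact: ricci_loc_sym.
Qed.

End ContractedBianchi.

(** * Algebra of cyclic sums and cubic forms *)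

Section CyclicSums.
Context {R : realFieldType}.

(* Contract the cyclic sum with the inverse metric H. The values c = 1/2 and c = 0 correspond
   to T and to Ric. *)
Lemma cyclic_sum_contraction n (C : 'I_n -> 'M[R]_n) (s : 'I_n -> R)
    (H G : 'M[R]_n) (c : R) :
  H^T = H -> G^T = G -> H *m G = 1%:M -> (forall m, (C m)^T = C m) ->
  (forall m, \sum_l \sum_k H l k * C m l k = s m) ->
  (forall m, (\sum_l \sum_k H l k * C l k m) *+ 2 = s m) ->
  (forall m l k, (C m l k - c * s m * G l k) + (C l k m - c * s l * G k m)
    + (C k m l - c * s k * G m l) = 0) ->
  forall m, (2 - (n%:R + 2) * c) * s m = 0.
Proof.
move=> Hs Gs HG Cs tr1 tr2 cyc m.
have HE l k : H l k = H k l by rewrite -{1}Hs mxE.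
have GE l k : G l k = G k l by rewrite -{1}Gs mxE.
have CE a l k : C a l k = C a k l by rewrite -{1}(Cs a) mxE.
have HGE l k : \sum_j H l j * G j k = (l == k)%:R.
  by move/matrixP : HG => /(_ l k); rewrite !mxE.
have sHG : \sum_l \sum_k H l k * (s l * G k m) = s m.
  rewrite (bigD1 m)//= [X in _ + X]big1 ?addr0.
    under eq_bigr do rewrite mulrCA; rewrite -mulr_sumr HGE eqxx mulr1//.
  move=> l lm; under eq_bigr do rewrite mulrCA.
  by rewrite -mulr_sumr HGE (negbTE lm) mulr0.
have trG : \sum_l \sum_k H l k * G l k = n%:R.
  transitivity (\sum_(l < n) (1 : R)); last by rewrite sumr_const card_ord.
  apply: eq_bigr => l _.
  transitivity (\sum_j H l j * G j l); last by rewrite HGE eqxx.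
  by apply: eq_bigr => k _; rewrite GE.
pose S (f : 'I_n -> 'I_n -> R) := \sum_l \sum_k H l k * f l k.
have SD f h : S (fun l k => f l k + h l k) = S f + S h.
  rewrite -big_split; apply: eq_bigr => l _; rewrite -big_split.
  by apply: eq_bigr => k _; rewrite mulrDr.
have SZ a f : S (fun l k => a * f l k) = a * S f.
  rewrite mulr_sumr; apply: eq_bigr => l _; rewrite mulr_sumr.
  by apply: eq_bigr => k _; rewrite mulrCA.
have X1 : S (fun l k => C k m l) = S (fun l k => C l k m).
  rewrite /S exchange_big/=; apply: eq_bigr => l _; apply: eq_bigr => k _.
  by rewrite HE CE.
have X2 : S (fun l k => s k * G m l) = s m.
  rewrite -[RHS]sHG /S exchange_big/=; apply: eq_bigr => l _; apply: eq_bigr => k _.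
  by rewrite HE GE.
(* After contraction the three C-terms give s_m, s_m / 2 and s_m / 2, and the three G-terms give n,
   1 and 1 times - c s_m. *)
have E : S (fun l k => C m l k + C l k m + C k m l + (- c * s m) * G l k
    + - c * (s l * G k m) + - c * (s k * G m l)) = 0.
  rewrite /S big1// => l _; rewrite big1// => k _; apply/eqP.
  rewrite mulf_eq0 -(cyc m l k); apply/orP; right; apply/eqP; ring.
have tr2m : S (fun l k => C l k m) *+ 2 = s m := tr2 m.
have tr1m : S (fun l k => C m l k) = s m := tr1 m.
have trGm : S (fun l k => G l k) = n%:R := trG.
have sHGm : S (fun l k => s l * G k m) = s m := sHG.
rewrite !SD !SZ X1 X2 sHGm trGm tr1m in E.
rewrite -[RHS]E -tr2m; ring.
Qed.

(** Polarization on basis vectors gives a sum over all six orders of the indices; symmetry in the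
    last two makes it twice the cyclic sum. *)
Lemma cubic_form_eq0 n (P : 'I_n -> 'I_n -> 'I_n -> R) :
  (forall m i j, P m i j = P m j i) ->
  (forall v : 'I_n -> R, \sum_m \sum_i \sum_j P m i j * v m * v i * v j = 0) ->
  forall i j k, P k i j + P i j k + P j k i = 0.
Proof.
move=> Ps f0 i j k.
pose T (u v w : 'I_n -> R) := \sum_m \sum_i \sum_j P m i j * u m * v i * w j.
have T1 u u' v w : T (fun a => u a + u' a) v w = T u v w + T u' v w.
  rewrite -big_split; apply: eq_bigr => a _; rewrite -big_split; apply: eq_bigr => b _.
  by rewrite -big_split; apply: eq_bigr => c _ /=; ring.
have T2 u v v' w : T u (fun a => v a + v' a) w = T u v w + T u v' w.
  rewrite -big_split; apply: eq_bigr => a _; rewrite -big_split; apply: eq_bigr => b _.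
  by rewrite -big_split; apply: eq_bigr => c _ /=; ring.
have T3 u v w w' : T u v (fun a => w a + w' a) = T u v w + T u v w'.
  rewrite -big_split; apply: eq_bigr => a _; rewrite -big_split; apply: eq_bigr => b _.
  by rewrite -big_split; apply: eq_bigr => c _ /=; ring.
have Te a b c : T (fun x => (x == a)%:R) (fun x => (x == b)%:R) (fun x => (x == c)%:R)
    = P a b c.
  rewrite /T (bigD1 a)//= [X in _ + X]big1 ?addr0; last first.
    move=> m /negbTE ma; rewrite big1// => p _; rewrite big1// => q _.
    by rewrite ma mulr0 !mul0r.
  rewrite (bigD1 b)//= [X in _ + X]big1 ?addr0; last first.
    by move=> m /negbTE ma; rewrite big1// => p _; rewrite ma mulr0 mul0r.
  rewrite (bigD1 c)//= [X in _ + X]big1 ?addr0; last first.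
    by move=> m /negbTE ma; rewrite ma mulr0.
  by rewrite !eqxx !mulr1.
(* Inclusion-exclusion over the values of the form at u + v + w, at the pairwise sums and at the
   single vectors. *)
have polar u v w : T u v w + T u w v + T v u w + T v w u + T w u v + T w v u = 0.
  have F0 x : T x x x = 0 by exact: f0.
  have := F0 (fun a => u a + v a + w a); have := F0 (fun a => u a + v a).
  have := F0 (fun a => u a + w a); have := F0 (fun a => v a + w a).
  rewrite !(T1, T2, T3) !F0.
  move: (T u u v) (T u u w) (T u v u) (T u v v) (T u v w) (T u w u) (T u w v) (T u w w).
  move: (T v u u) (T v u v) (T v u w) (T v v u) (T v v w) (T v w u) (T v w v) (T v w w).
  move: (T w u u) (T w u v) (T w u w) (T w v u) (T w v v) (T w v w) (T w w u) (T w w v).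
  move=> *; lra.
have := polar (fun x => (x == k)%:R) (fun x => (x == i)%:R) (fun x => (x == j)%:R).
rewrite !Te (Ps k j i) (Ps i k j) (Ps j i k) => E; lra.
Qed.

(** Renaming the summation indices cyclically does not change the form, so three times its value is
    the form of the cyclic sum. *)
Lemma cubic_form_cyclic n (P : 'I_n -> 'I_n -> 'I_n -> R) (v : 'I_n -> R) :
  (forall i j k, P k i j + P i j k + P j k i = 0) ->
  \sum_m \sum_i \sum_j P m i j * v m * v i * v j = 0.
Proof.
move=> cyc; pose S := \sum_m \sum_i \sum_j P m i j * v m * v i * v j.
have E1 : \sum_m \sum_i \sum_j P i j m * v m * v i * v j = S.
  rewrite /S exchange_big/=; apply: eq_bigr => i _; rewrite exchange_big/=.
  by apply: eq_bigr => j _; apply: eq_bigr => m _; ring.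
have E2 : \sum_m \sum_i \sum_j P j m i * v m * v i * v j = S.
  under eq_bigr do rewrite exchange_big/=; rewrite exchange_big/=.
  by apply: eq_bigr => i _; apply: eq_bigr => j _; apply: eq_bigr => m _; ring.
have : S + \sum_m \sum_i \sum_j P i j m * v m * v i * v j
    + \sum_m \sum_i \sum_j P j m i * v m * v i * v j = 0.
  rewrite /S -!big_split big1// => m _; rewrite -!big_split big1// => i _.
  rewrite -!big_split big1// => j _ /=.
  by rewrite -!mulrDl cyc !mul0r.
rewrite E1 E2 -/S; lra.
Qed.

End CyclicSums.

(** * Cyclic conditions for T and for Ric in one chart *)

Section Omega1Local.
Context {R : realType}.
Local Notation V := 'rV[R]_4.
Variables (D : set V) (g : V -> 'M[R]_4).
Hypotheses (oD : open D) (gD : smooth_mx D g).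
Hypothesis g_sym : forall x, D x -> (g x)^T = g x.
Hypothesis g_unit : forall x, D x -> g x \in unitmx.

Let T x := ricci_loc g x - (2^-1 * scalar_loc g x) *: g x.

(** The metric is parallel, so only the scalar factor in front of it is differentiated. *)
Lemma covariant_energy_momentum m x : D x -> covariant_mx g T m x =
  covariant_mx g (ricci_loc g) m x - (2^-1 * partial m (scalar_loc g) x) *: g x.
Proof.
move=> Dx.
have sS := smooth_scalar_loc oD gD g_sym g_unit.
have sSg : smooth_mx D (fun y => (2^-1 * scalar_loc g y) *: g y).
  move=> a b; apply: (smooth_ext oD (f := fun y => 2^-1 * scalar_loc g y * g y a b)).
    by move=> y _; rewrite mxE.
  exact: (smoothM oD (smoothM oD (@smooth_cst _ _ D 2^-1) sS) (gD a b)).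
have dR : derivable_mx m (ricci_loc g) x.
  exact: smooth_derivable_mx (smooth_ricci_loc oD gD g_sym g_unit) Dx.
have dSg : derivable_mx m (fun y => (2^-1 * scalar_loc g y) *: g y) x.
  exact: smooth_derivable_mx sSg Dx.
have pSg : partial_mx m (fun y => (2^-1 * scalar_loc g y) *: g y) x =
    (2^-1 * partial m (scalar_loc g) x) *: g x +
    (2^-1 * scalar_loc g x) *: partial_mx m g x.
  apply/matrixP => a b; rewrite entryD mxE [X in _ = _ + X]mxE !partial_mxE.
  have -> : (fun y => ((2^-1 * scalar_loc g y) *: g y) a b) =
      fun y => 2^-1 * scalar_loc g y * g y a b by apply/funext => y; rewrite mxE.
  have ds : derivable (scalar_loc g) x (delta_mx 0 m) by exact: smooth_derivable sS Dx.
  have dc : derivable (fun=> 2^-1 : R) x (delta_mx 0 m) by exact: derivable_cst.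
  have dg : derivable (fun y => g y a b) x (delta_mx 0 m).
    exact: smooth_derivable (gD a b) Dx.
  by rewrite (partialM (derivableM dc ds) dg) (partialM dc ds) partial_cst mul0r add0r.
rewrite /covariant_mx /T (partial_mxB dR dSg) pSg.
rewrite (metric_compatibility oD g_sym g_unit m Dx).
move: (partial_mx _ _ _) (ricci_loc g x) (connection_mx g m x) (g x) => P Q A G.
move: (2^-1 * _) (2^-1 * _) => s t.
rewrite mulmxBr mulmxBl -!scalemxAl -!scalemxAr scalerDr.
move: (A *m Q) (Q *m _) (A *m G) (G *m _) => B C E F.
by apply/matrixP => a b; rewrite !mxE; ring.
Qed.

Lemma Omega1_local_iff :
  (forall x, D x -> forall i j k, nabla_cov2 g T k i j x + nabla_cov2 g T i j k x
    + nabla_cov2 g T j k i x = 0) <->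
  (forall x, D x -> forall i j k, nabla_cov2 g (ricci_loc g) k i j x
    + nabla_cov2 g (ricci_loc g) i j k x + nabla_cov2 g (ricci_loc g) j k i x = 0).
Proof.
have [C CE] : exists C, forall x m, C x m = covariant_mx g (ricci_loc g) m x.
  by exists (fun x m => covariant_mx g (ricci_loc g) m x).
have [s sE] : exists s, forall x m, s x m = partial m (scalar_loc g) x.
  by exists (fun x m => partial m (scalar_loc g) x).
have TE x m i j : D x -> nabla_cov2 g T m i j x = C x m i j - 2^-1 * s x m * g x i j.
  move=> Dx; rewrite nabla_cov2E covariant_energy_momentum// entryD entryN CE sE.
  by rewrite [in X in _ - X]mxE.
have RE x m i j : nabla_cov2 g (ricci_loc g) m i j x = C x m i j.
  by rewrite nabla_cov2E CE.
have key x (Dx : D x) c (cyc : forall m l k, (C x m l k - c * s x m * g x l k)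
    + (C x l k m - c * s x l * g x k m) + (C x k m l - c * s x k * g x m l) = 0) m :
    (2 - (4%:R + 2) * c) * s x m = 0.
  apply: (cyclic_sum_contraction _ (g_sym Dx) (mulVmx (g_unit Dx)) _ _ _ cyc) => [|a|a|a].
  - by rewrite trmx_inv g_sym.
  - by rewrite CE (covariant_ricci_sym oD gD g_sym g_unit a Dx).
  - by rewrite CE sE (trace_covariant_ricci oD gD g_sym g_unit a Dx).
  - rewrite sE -(contracted_bianchi oD gD g_sym g_unit a Dx); congr (_ *+ 2).
    by apply: eq_bigr => l _; apply: eq_bigr => k _; rewrite CE.
have sum3 (a b d a' b' d' : R) : a = a' -> b = b' -> d = d' -> a + b + d = 0 ->
    a' + b' + d' = 0 by move=> -> -> ->.
split=> H x Dx i j k.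
- have cyc a b d : (C x a b d - 2^-1 * s x a * g x b d)
      + (C x b d a - 2^-1 * s x b * g x d a) + (C x d a b - 2^-1 * s x d * g x a b) = 0.
    have := sum3 _ _ _ _ _ _ (TE x a b d Dx) (TE x b d a Dx) (TE x d a b Dx).
    apply. exact (H x Dx b d a).
  (* Here c = 1/2 and n = 4: the coefficient is 2 - 6/2 = -1. *)
  have s0 m : s x m = 0.
    have /eqP := key x Dx _ cyc m; rewrite mulf_eq0 => /orP[/eqP E|/eqP//].
    by exfalso; move: E; lra.
  have E m a b : nabla_cov2 g T m a b x = nabla_cov2 g (ricci_loc g) m a b x.
    by rewrite TE// RE s0 mulr0 mul0r subr0.
  exact: (sum3 _ _ _ _ _ _ (E k i j) (E i j k) (E j k i) (H x Dx i j k)).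
- have cyc a b d : (C x a b d - 0 * s x a * g x b d)
      + (C x b d a - 0 * s x b * g x d a) + (C x d a b - 0 * s x d * g x a b) = 0.
    rewrite !mul0r !subr0.
    exact: (sum3 _ _ _ _ _ _ (RE x a b d) (RE x b d a) (RE x d a b) (H x Dx b d a)).
  (* Here c = 0: the coefficient is 2. *)
  have s0 m : s x m = 0.
    have /eqP := key x Dx _ cyc m.
    by rewrite mulr0 subr0 mulf_eq0 pnatr_eq0/= => /eqP.
  have E m a b : nabla_cov2 g (ricci_loc g) m a b x = nabla_cov2 g T m a b x.
    by rewrite TE// RE s0 mulr0 mul0r subr0.
  exact: (sum3 _ _ _ _ _ _ (E k i j) (E i j k) (E j k i) (H x Dx i j k)).
Qed.

End Omega1Local.

(** * Change of coordinates *)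

Lemma christoffel_quadratic (R : realType) n (g : 'rV[R]_n -> 'M[R]_n) (x v : 'rV[R]_n) k :
  \sum_i \sum_j christoffel g k i j x * v 0 i * v 0 j =
  (v *m \sum_i v 0 i *: connection_mx g i x) 0 k.
Proof.
rewrite exchange_big mxE; apply: eq_bigr => j _; rewrite summxE mulr_sumr.
by apply: eq_bigr => i _; rewrite mxE connection_mxE; ring.
Qed.

Section CoordinateChange.
Context {R : realType} {n : nat}.
Local Notation V := 'rV[R]_n.
Variables (O D D' : set V) (phi : V -> V) (g g' : V -> 'M[R]_n).
Hypotheses (oO : open O) (oD : open D) (oD' : open D') (OD : O `<=` D).
Hypothesis phiD' : forall x, O x -> D' (phi x).
Hypothesis phi_smooth : forall k, smooth_on O (fun x => phi x 0 k).
Hypotheses (gD : smooth_mx D g) (gD' : smooth_mx D' g').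
Hypothesis g_sym : forall x, D x -> (g x)^T = g x.
Hypothesis g'_sym : forall x, D' x -> (g' x)^T = g' x.
Hypothesis g_unit : forall x, D x -> g x \in unitmx.
Hypothesis g'_unit : forall x, D' x -> g' x \in unitmx.

(** Rows belong to the old coordinates, so a velocity, written as a row v, becomes [v *m J]. *)
Definition jacobian_mx (x : V) : 'M[R]_n :=
  \matrix_(i, k) partial i (fun y => phi y 0 k) x.
Local Notation J := jacobian_mx.
Hypothesis g_change : forall x, O x -> g x = J x *m g' (phi x) *m (J x)^T.

Local Notation Gam := (connection_mx g).
Local Notation Gam' := (connection_mx g').

Lemma jacobian_mx_entry i k : (fun y => J y i k) = partial i (fun y => phi y 0 k).
Proof. by apply/funext => y; rewrite mxE. Qed.

Lemma smooth_jacobian : smooth_mx O J.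
Proof. by move=> i k; rewrite jacobian_mx_entry; exact: smooth_partial. Qed.

Lemma partial_jacobianC i j k x : O x ->
  partial_mx i J x j k = partial_mx j J x i k.
Proof.
move=> Ox; rewrite !partial_mxE !jacobian_mx_entry.
exact: partialC oO Ox (phi_smooth k).
Qed.

(** Invertibility of J is read off from the nondegeneracy of g = J g' J^T rather than from an
    inverse coordinate change. *)
Lemma jacobian_unit x : O x -> J x \in unitmx.
Proof.
move=> Ox; have := g_unit (OD Ox); rewrite g_change// !unitmx_mul.
by move=> /andP[/andP[]].
Qed.

Lemma is_derive_comp_phi h i x : smooth_on D' h -> O x ->
  is_derive x (delta_mx 0 i) (fun y => h (phi y))
    (\sum_b partial b h (phi x) * J x i b).
Proof.
move=> hD Ox; apply: chain_rule.
- apply: filterS (open_nbhs_nbhs (conj oD' (phiD' Ox))) => y Dy j.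
  exact: smooth_derivable hD Dy.
- by move=> j; exact: smooth_continuous (smooth_partial j hD) (phiD' Ox).
- move=> j; rewrite mxE; exact: smooth_is_derive (phi_smooth j) Ox.
Qed.

Lemma partial_mx_comp p q (F : V -> 'M[R]_(p, q)) i x : smooth_mx D' F -> O x ->
  derivable_mx i (fun y => F (phi y)) x /\
  partial_mx i (fun y => F (phi y)) x = \sum_b J x i b *: partial_mx b F (phi x).
Proof.
move=> FD Ox; split.
  by move=> a b; have [] := is_derive_comp_phi i (FD a b) Ox.
apply/matrixP => a b; rewrite partial_mxE summxE.
have [_ E] := is_derive_comp_phi i (FD a b) Ox.
apply: etrans E _; apply: eq_bigr => c _.
by rewrite [RHS]mxE partial_mxE mulrC.
Qed.

Definition pullback_connection (i : 'I_n) (x : V) : 'M[R]_n :=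
  \sum_b J x i b *: Gam' b (phi x).
Local Notation Gt := pullback_connection.

(* The right-hand side times J^-1 is torsion free and compatible with g. *)
Lemma connection_mx_change i x : O x ->
  Gam i x *m J x = partial_mx i J x + J x *m Gt i x.
Proof.
move=> Ox; have Dx := OD Ox; have Ju := jacobian_unit Ox.
pose X j := partial_mx j J x + J x *m Gt j x.
rewrite -/(X i).
(* Torsion freeness of the candidate: second derivatives of [phi] commute and the new Christoffel
   symbols are symmetric. *)
have XC a b k : X a b k = X b a k.
  rewrite /X !entryD partial_jacobianC//; congr (_ + _).
  rewrite !mxE; under eq_bigr do rewrite summxE mulr_sumr.
  rewrite exchange_big/=; apply: eq_bigr => c _.
  rewrite summxE mulr_sumr; apply: eq_bigr => d _.
  rewrite !(mxE, connection_mxE) (christoffelC oD' g'_sym); last exact: phiD'.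
  exact: mulrCA.
suff -> : Gam i x = X i *m invmx (J x) by rewrite mulmxKV.
apply: (torsion_free_metric_unique (A := fun j => Gam j x)
  (B := fun j => X j *m invmx (J x)) (g_sym Dx) (g_unit Dx)) => [a b k|a b k|a].
- by rewrite !connection_mxE (christoffelC oD g_sym).
- by rewrite !mxE; apply: eq_bigr => c _; rewrite XC.
rewrite -(metric_compatibility oD g_sym g_unit a Dx).
rewrite (partial_mx_open a oO Ox g_change).
have [dg' pg'] := partial_mx_comp a gD' Ox.
have dJ : derivable_mx a J x by exact: smooth_derivable_mx smooth_jacobian Ox.
have dJt := derivable_mx_tr dJ; have dJg := derivable_mxM dJ dg'.
rewrite (partial_mxM dJg dJt) (partial_mxM dJ dg') partial_mx_tr pg' g_change//.
have -> : \sum_b J x a b *: partial_mx b g' (phi x) =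
    Gt a x *m g' (phi x) + g' (phi x) *m (Gt a x)^T.
  rewrite /Gt linear_sum/= mulmx_suml mulmx_sumr -big_split/=.
  apply: eq_bigr => b _; rewrite linearZ/= -scalemxAl -scalemxAr -scalerDr.
  by rewrite (metric_compatibility oD' g'_sym g'_unit b (phiD' Ox)).
rewrite /X.
exact: gauge_metric_algebra Ju.
Qed.

Lemma partial_pullback l i x : O x ->
  derivable_mx l (Gt i) x /\ partial_mx l (Gt i) x =
  \sum_b partial_mx l J x i b *: Gam' b (phi x) +
  \sum_b \sum_c (J x i b * J x l c) *: partial_mx c (Gam' b) (phi x).
Proof.
move=> Ox.
have sG b : smooth_mx D' (Gam' b) by exact: smooth_connection.
have dJ k : derivable (fun y => J y i k) x (delta_mx 0 l).
  exact: smooth_derivable (smooth_jacobian i k) Ox.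
have dG b : derivable_mx l (fun y => Gam' b (phi y)) x.
  by have [] := partial_mx_comp l (sG b) Ox.
have E a c : (fun y => Gt i y a c) = fun y => \sum_b J y i b * Gam' b (phi y) a c.
  by apply/funext => y; rewrite summxE; apply: eq_bigr => b _; rewrite mxE.
split=> [a c|].
  rewrite E; apply: derivable_sum_fin => b; exact: (derivableM (dJ b) (dG b a c)).
apply/matrixP => a c; rewrite partial_mxE E partial_sum; last first.
  by move=> b; exact: (derivableM (dJ b) (dG b a c)).
rewrite entryD !summxE -big_split/=; apply: eq_bigr => b _.
rewrite (partialM (dJ b) (dG b a c)); congr (_ + _).
  by rewrite [RHS]mxE partial_mxE.
have [_ E'] := partial_mx_comp l (sG b) Ox.
rewrite -[partial l _ x]partial_mxE E' !summxE mulr_sumr; apply: eq_bigr => d _.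
by rewrite [X in _ * X]mxE [RHS]mxE mulrA.
Qed.

(** The gauge law is differentiated and antisymmetrized in l and i. *)
Lemma curvature_mx_change l i x : O x -> curvature_mx g l i x *m J x =
  J x *m \sum_b \sum_c (J x i b * J x l c) *: curvature_mx g' c b (phi x).
Proof.
move=> Ox; have Dx := OD Ox.
have [dGi pGi] := partial_pullback l i Ox; have [dGl pGl] := partial_pullback i l Ox.
have dJ a : derivable_mx a J x by exact: smooth_derivable_mx smooth_jacobian Ox.
have dP a b : derivable_mx a (partial_mx b J) x.
  exact: smooth_derivable_mx (smooth_partial_mx b smooth_jacobian) Ox.
have dGam a b : derivable_mx a (Gam b) x.
  exact: smooth_derivable_mx (smooth_connection oD gD g_unit b) Dx.
have diff a b : derivable_mx a (Gt b) x ->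
    partial_mx a (Gam b) x *m J x + Gam b x *m partial_mx a J x =
    partial_mx a (partial_mx b J) x + (partial_mx a J x *m Gt b x
      + J x *m partial_mx a (Gt b) x).
  move=> dGt; rewrite -(partial_mxM (dGam a b) (dJ a)) -(partial_mxM (dJ a) dGt).
  rewrite -(partial_mxD (dP a b) (derivable_mxM (dJ a) dGt)).
  exact: partial_mx_open oO Ox (connection_mx_change b).
have Hl := diff l i dGi; have Hi := diff i l dGl.
rewrite (partial_mxC i l oO Ox smooth_jacobian) in Hi.
rewrite (gauge_curvature_algebra (connection_mx_change i Ox) (connection_mx_change l Ox) Hl Hi).
congr (_ *m _); rewrite pGi pGl.
(* Terms with a derivative of J are symmetric in i and l, so they drop out of the difference. *)
have -> : \sum_b partial_mx i J x l b *: Gam' b (phi x) =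
    \sum_b partial_mx l J x i b *: Gam' b (phi x).
  by apply: eq_bigr => b _; rewrite partial_jacobianC.
have -> : \sum_b \sum_c (J x l b * J x i c) *: partial_mx c (Gam' b) (phi x) =
    \sum_b \sum_c (J x i b * J x l c) *: partial_mx b (Gam' c) (phi x).
  rewrite exchange_big/=; apply: eq_bigr => b _; apply: eq_bigr => c _.
  by rewrite mulrC.
have GG a b : Gt a x *m Gt b x =
    \sum_p \sum_q (J x a p * J x b q) *: (Gam' p (phi x) *m Gam' q (phi x)).
  rewrite mulmx_suml; apply: eq_bigr => p _; rewrite mulmx_sumr.
  by apply: eq_bigr => q _; rewrite -scalemxAl -scalemxAr scalerA.
have GG' : Gt l x *m Gt i x =
    \sum_p \sum_q (J x i p * J x l q) *: (Gam' q (phi x) *m Gam' p (phi x)).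
  rewrite GG exchange_big/=; apply: eq_bigr => p _; apply: eq_bigr => q _.
  by rewrite mulrC.
rewrite GG GG' opprD addrACA subrr add0r.
rewrite -!sumrB -big_split -sumrB/=; apply: eq_bigr => b _.
rewrite -!sumrB -big_split -sumrB/=; apply: eq_bigr => c _.
by rewrite /curvature_mx !scalerBr scalerDr scalerBr.
Qed.

Lemma ricci_loc_change x : O x ->
  ricci_loc g x = J x *m ricci_loc g' (phi x) *m (J x)^T.
Proof.
move=> Ox; have Dx := OD Ox; have Ju := jacobian_unit Ox.
have KJ b c : \sum_k invmx (J x) b k * J x k c = (b == c)%:R.
  by have := mulVmx Ju; move/matrixP => /(_ b c); rewrite !mxE.
apply/matrixP => i j; rewrite (ricci_locE oD g_sym)//.
(* The curvature is conjugated by J; in the trace over k the factor J^-1 meets the J of the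
   contracted form index, leaving a Kronecker delta. *)
have FE k : curvature_mx g k j x i k = \sum_a \sum_p \sum_q \sum_b
    (invmx (J x) b k * J x k q) * (J x i a * J x j p * curvature_mx g' q p (phi x) a b).
  rewrite -[curvature_mx g k j x](mulmxK Ju) curvature_mx_change// -mulmxA mxE.
  apply: eq_bigr => a _; rewrite mulmx_suml summxE mulr_sumr.
  apply: eq_bigr => p _; rewrite mulmx_suml summxE mulr_sumr.
  apply: eq_bigr => q _; rewrite -scalemxAl [X in _ * X]mxE.
  rewrite [X in _ * (_ * X)]mxE !mulr_sumr; apply: eq_bigr => b _; ring.
under eq_bigr do rewrite FE.
rewrite exchange_big/= mxE.
under [RHS]eq_bigr do rewrite mxE mulr_suml.
rewrite [RHS]exchange_big/=; apply: eq_bigr => a _.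
rewrite exchange_big/=; apply: eq_bigr => p _.
rewrite [(J x)^T p j]mxE (ricci_locE oD' g'_sym); last exact: phiD'.
rewrite mulr_sumr mulr_suml exchange_big/=; apply: eq_bigr => q _.
rewrite exchange_big/= (bigD1 q)//= [X in _ + X]big1 ?addr0; last first.
  by move=> b bq; rewrite -mulr_suml KJ (negbTE bq) mul0r.
rewrite -mulr_suml KJ eqxx mul1r; ring.
Qed.

Lemma connection_along_change x (v : V) : O x ->
  (\sum_i v 0 i *: Gam i x) *m J x = \sum_i v 0 i *: partial_mx i J x
    + J x *m \sum_b (v *m J x) 0 b *: Gam' b (phi x).
Proof.
move=> Ox; rewrite mulmx_suml.
under eq_bigr do rewrite -scalemxAl connection_mx_change// scalerDr scalemxAr.
rewrite big_split/= -mulmx_sumr; congr (_ + _ *m _).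
under [LHS]eq_bigr do rewrite /pullback_connection scaler_sumr.
rewrite exchange_big; apply: eq_bigr => b _.
rewrite [in RHS]mxE scaler_suml; apply: eq_bigr => i _.
by rewrite scalerA.
Qed.

Lemma curve_velocity_change (X : R -> V) t (v : V) : O (X t) ->
  (forall k, is_derive t 1 (fun s => X s 0 k) (v 0 k)) ->
  forall a, is_derive t 1 (fun s => phi (X s) 0 a) ((v *m J (X t)) 0 a).
Proof.
move=> OX dX a.
have -> : (v *m J (X t)) 0 a =
    \sum_i partial i (fun y => phi y 0 a) (X t) * v 0 i.
  by rewrite mxE; apply: eq_bigr => i _; rewrite -jacobian_mx_entry mulrC.
apply: (chain_rule (f := fun y => phi y 0 a)) => // [|i].
  apply: filterS (open_nbhs_nbhs (conj oO OX)) => y Oy i.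
  exact: smooth_derivable (phi_smooth a) Oy.
exact: smooth_continuous (smooth_partial i (phi_smooth a)) OX.
Qed.

(** The derivative of J along the curve is exactly compensated by the inhomogeneous term of the
    gauge law, so the geodesic equation keeps its form. *)
Lemma curve_acceleration_change (X U : R -> V) t : O (X t) ->
  (forall k, is_derive t 1 (fun s => X s 0 k) (U t 0 k)) ->
  (forall k, is_derive t 1 (fun s => U s 0 k)
    (- (U t *m \sum_i U t 0 i *: Gam i (X t)) 0 k)) ->
  let w := U t *m J (X t) in
  forall a, is_derive t 1 (fun s => (U s *m J (X s)) 0 a)
    (- (w *m \sum_b w 0 b *: Gam' b (phi (X t))) 0 a).
Proof.
move=> OX dX dU w a.
have dJ i : is_derive t 1 (fun s => J (X s) i a)
    ((\sum_j U t 0 j *: partial_mx j J (X t)) i a).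
  rewrite summxE.
  have -> : \sum_j (U t 0 j *: partial_mx j J (X t)) i a =
      \sum_j partial j (fun y => J y i a) (X t) * U t 0 j.
    by apply: eq_bigr => j _; rewrite mxE partial_mxE mulrC.
  apply: (chain_rule (f := fun y => J y i a)) => // [|j].
    apply: filterS (open_nbhs_nbhs (conj oO OX)) => y Oy j.
    exact: smooth_derivable (smooth_jacobian i a) Oy.
  exact: smooth_continuous (smooth_partial j (smooth_jacobian i a)) OX.
under eq_fun do rewrite mxE.
apply: (is_derive_eq (is_derive_sum_pointwise
  (fun i => is_derive_mul_pointwise (dU i) (dJ i)))).
rewrite big_split/=.
have -> : \sum_i U t 0 i * (\sum_j U t 0 j *: partial_mx j J (X t)) i a =
    (U t *m \sum_j U t 0 j *: partial_mx j J (X t)) 0 a by rewrite mxE.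
have -> : \sum_i - (U t *m \sum_i U t 0 i *: Gam i (X t)) 0 i * J (X t) i a =
    - (U t *m (\sum_i U t 0 i *: Gam i (X t)) *m J (X t)) 0 a.
  by rewrite [X in - X]mxE -sumrN; apply: eq_bigr => i _; rewrite mulNr.
rewrite -mulmxA connection_along_change// mulmxDr mulmxA -/w entryD opprD.
by rewrite addrAC addNr add0r.
Qed.

End CoordinateChange.

(** * Derivative of a quadratic form along a geodesic *)

Section TensorAlongCurve.
Context {R : realType} {n : nat}.
Local Notation V := 'rV[R]_n.

Lemma derive_quadratic_along_geodesic (D : set V) (g a : V -> 'M[R]_n) (X U : R -> V) t :
  open D -> smooth_mx D a -> D (X t) ->
  (forall k, is_derive t 1 (fun s => X s 0 k) (U t 0 k)) ->
  (forall k, is_derive t 1 (fun s => U s 0 k)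
    (- (U t *m \sum_i U t 0 i *: connection_mx g i (X t)) 0 k)) ->
  is_derive t 1 (fun s => \sum_i \sum_j a (X s) i j * U s 0 i * U s 0 j)
    (\sum_m \sum_i \sum_j nabla_cov2 g a m i j (X t) * U t 0 m * U t 0 i * U t 0 j).
Proof.
move=> oD aD DX dX dU.
pose v := U t; pose A := a (X t).
pose dA := \sum_m v 0 m *: partial_mx m a (X t).
pose G := \sum_m v 0 m *: connection_mx g m (X t).
have da i j : is_derive t 1 (fun s => a (X s) i j) (dA i j).
  rewrite /dA summxE.
  have -> : \sum_m (v 0 m *: partial_mx m a (X t)) i j =
      \sum_m partial m (fun y => a y i j) (X t) * v 0 m.
    by apply: eq_bigr => m _; rewrite mxE partial_mxE mulrC.
  apply: (chain_rule (f := fun y => a y i j)) => // [|m].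
    apply: filterS (open_nbhs_nbhs (conj oD DX)) => y Dy m.
    exact: smooth_derivable (aD i j) Dy.
  exact: smooth_continuous (smooth_partial m (aD i j)) DX.
apply: (is_derive_eq (is_derive_sum_pointwise (fun i => is_derive_sum_pointwise (fun j =>
  is_derive_mul_pointwise (is_derive_mul_pointwise (da i j) (dU i)) (dU j))))).
rewrite -/v -/A -/G.
have bil (B : 'M[R]_n) (u w : V) :
    \sum_i \sum_j B i j * u 0 i * w 0 j = (u *m B *m w^T) 0 0.
  rewrite exchange_big mxE; apply: eq_bigr => j _; rewrite mxE [X in _ * X]mxE mulr_suml.
  by apply: eq_bigr => i _; rewrite [B i j * _]mulrC.
(* The geodesic equation has replaced U' by - U G; the two velocity factors thus supply the two
   Christoffel corrections of the covariant derivative. *)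
transitivity ((v *m (dA - G *m A - A *m G^T) *m v^T) 0 0).
  rewrite mulmxBr mulmxBl mulmxBr mulmxBl !entryD !entryN.
  have -> : v *m (G *m A) *m v^T = v *m G *m A *m v^T by rewrite mulmxA.
  have -> : v *m (A *m G^T) *m v^T = v *m A *m (v *m G)^T.
    by rewrite trmx_mul !mulmxA.
  rewrite -!bil -!sumrB; apply: eq_bigr => i _; rewrite -!sumrB; apply: eq_bigr => j _.
  ring.
have -> : dA - G *m A - A *m G^T = \sum_m v 0 m *: covariant_mx g a m (X t).
  rewrite /dA /G linear_sum/= mulmx_suml mulmx_sumr -!sumrB; apply: eq_bigr => m _.
  by rewrite linearZ/= -scalemxAl -scalemxAr -!scalerBr.
rewrite -bil.
under eq_bigr do under eq_bigr do rewrite summxE !mulr_suml.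
under eq_bigr do rewrite exchange_big; rewrite exchange_big/=.
apply: eq_bigr => m _; apply: eq_bigr => i _; apply: eq_bigr => j _.
by rewrite nabla_cov2E [X in X * _ * _ = _]mxE [v 0 m * _]mulrC.
Qed.

End TensorAlongCurve.

Section Constancy.
Context {R : realType}.

Lemma constant_on_interval (I : set R) (f : R -> R) : is_interval I ->
  (forall t, I t -> is_derive t 1 f 0) -> forall s t, I s -> I t -> f s = f t.
Proof.
move=> itvI df s t.
wlog st : s t / s <= t.
  by move=> H Is It; case/orP: (le_total s t) => st; [|apply/esym]; exact: H.
move=> Is It.
have inI c : c \in `[s, t] -> I c by rewrite in_itv/= => /(itvI _ _ Is It).
have [||c _] := @MVT_segment _ f (fun=> 0) s t st.
- by move=> c cst; apply/df/inI; exact: subset_itv_oo_cc.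
- by apply: derivable_within_continuous => c /inI /df[].
- by rewrite mul0r => /eqP; rewrite subr_eq0 eq_sym => /eqP.
Qed.

End Constancy.

(** * Space-times *)

Section SpaceTimeGeometry.
Context {R : realType} {M : topologicalType}.
Variables (A : set (chart R 4 M)) (g : components2 R 4 M).
Hypothesis stg : is_spacetime A g.
Implicit Types c d : chart R 4 M.

Lemma spacetime_smooth c : A c -> smooth_mx (chart_img c) (g c).
Proof. by move=> Ac i j; exact: (tensor2_smooth (spacetime_tensor stg) Ac). Qed.

Lemma spacetime_sym c x : A c -> chart_img c x -> (g c x)^T = g c x.
Proof. by move=> Ac; exact: (tensor2_sym (spacetime_tensor stg) Ac). Qed.

Lemma spacetime_unit c x : A c -> chart_img c x -> g c x \in unitmx.
Proof.
move=> Ac cx; have [P Pu ->] := spacetime_lorentz stg Ac cx.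
rewrite !unitmx_mul unitmx_tr Pu andbT/= unitmxE det_diag unitfE.
apply/prodf_neq0 => i _; rewrite mxE.
by case: ifP => _; rewrite ?oppr_eq0 oner_eq0.
Qed.

Lemma chart_img_open c : open (chart_img c). Proof. exact: img_open. Qed.
Arguments chart_img_open : clear implicits.

Lemma chart_dom_open c : open (dom c). Proof. exact: dom_open. Qed.
Arguments chart_dom_open : clear implicits.

Lemma overlap_sub c d : overlap c d `<=` chart_img c.
Proof. by move=> _ [p [cp _] <-]; exists p. Qed.

Lemma overlap_transition c d x : overlap c d x -> chart_img d (transition c d x).
Proof. by move=> [p [cp dp] <-]; exists p => //; rewrite /transition/= coordK. Qed.

Lemma overlapP c d x : chart_img c x -> dom d (param c x) -> overlap c d x.
Proof.
by move=> [p cp <-]; rewrite coordK// => dp; exists p.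
Qed.

(** Inside the chart image, the overlap is the preimage of [dom d] under the continuous map
    [param c]. *)
Lemma overlap_open c d : open (overlap c d).
Proof.
rewrite openE => x [p [cp dp] <-].
have cx : chart_img c (Defs.coord c p) by exists p.
have n1 := open_nbhs_nbhs (conj (chart_img_open c) cx).
have n2 : \forall y \near Defs.coord c p, dom d (param c y).
  apply: (param_cts cx); rewrite coordK//.
  exact: open_nbhs_nbhs (conj (chart_dom_open d) dp).
by apply: filterS2 n1 n2 => y; exact: overlapP.
Qed.

Lemma transition_smooth c d k : A c -> A d ->
  smooth_on (overlap c d) (fun x => transition c d x 0 k).
Proof.
move=> Ac Ad.
exact: (atlas_compat (manifold_atlas (spacetime_manifold stg)) Ac Ad).
Qed.

Lemma metric_change c d x : A c -> A d -> overlap c d x ->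
  g c x = jacobian_mx (transition c d) x *m g d (transition c d x)
    *m (jacobian_mx (transition c d) x)^T.
Proof. by move=> Ac Ad; exact: (tensor2_change (spacetime_tensor stg) Ac Ad). Qed.

Lemma ricci_change c d x : A c -> A d -> overlap c d x ->
  ricci g c x = jacobian_mx (transition c d) x *m ricci g d (transition c d x)
    *m (jacobian_mx (transition c d) x)^T.
Proof.
move=> Ac Ad Ox; rewrite /ricci.
apply: (@ricci_loc_change _ _ (overlap c d) (chart_img c) (chart_img d)) => //.
- exact: overlap_open.
- exact: chart_img_open.
- exact: chart_img_open.
- exact: overlap_sub.
- exact: overlap_transition.
- by move=> k; exact: transition_smooth.
- exact: spacetime_smooth.
- exact: spacetime_smooth.
- by move=> y; exact: spacetime_sym.
- by move=> y; exact: spacetime_sym.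
- by move=> y; exact: spacetime_unit.
- by move=> y; exact: spacetime_unit.
- by move=> y; exact: metric_change.
Qed.

Definition position c (gamma : R -> M) (t : R) := Defs.coord c (gamma t).
Definition velocity_row c (gamma : R -> M) (t : R) : 'rV[R]_4 :=
  \row_k velocity c gamma k t.

Definition quadratic_value (a : components2 R 4 M) c (gamma : R -> M) (t : R) : R :=
  \sum_i \sum_j a c (Defs.coord c (gamma t)) i j * velocity c gamma i t * velocity c gamma j t.

Section AlongGeodesic.
Variables (I : set R) (gamma : R -> M).
Hypotheses (oI : open I) (geo : is_geodesic A g I gamma).

Lemma geodesic_near_dom c t : I t -> dom c (gamma t) ->
  \forall s \near t, I s /\ dom c (gamma s).
Proof.
move=> It ct; have n1 := open_nbhs_nbhs (conj oI It).
have n2 : \forall s \near t, dom c (gamma s).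
  apply: (geodesic_cts geo It); exact: open_nbhs_nbhs (conj (chart_dom_open c) ct).
by apply: filterS2 n1 n2.
Qed.

Lemma geodesic_velocity c t : A c -> I t -> dom c (gamma t) -> forall k,
  is_derive t 1 (fun s => position c gamma s 0 k) (velocity_row c gamma t 0 k).
Proof.
move=> Ac It ct k; have [dx _ _] := geodesic_eq geo It Ac ct k.
by rewrite mxE /velocity derive1E; exact: derivableP.
Qed.

Lemma geodesic_acceleration c t : A c -> I t -> dom c (gamma t) -> forall k,
  is_derive t 1 (fun s => velocity_row c gamma s 0 k)
    (- (velocity_row c gamma t *m \sum_i velocity_row c gamma t 0 i
        *: connection_mx (g c) i (position c gamma t)) 0 k).
Proof.
move=> Ac It ct k; have [_ dv /eqP] := geodesic_eq geo It Ac ct k.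
rewrite addr_eq0 derive1E => /eqP E.
under eq_fun do rewrite mxE.
rewrite -christoffel_quadratic.
apply: (is_derive_eq (derivableP dv)); rewrite E; congr (- _).
by apply: eq_bigr => i _; apply: eq_bigr => j _; rewrite !mxE.
Qed.

Lemma velocity_row_change c d t : A c -> A d -> I t ->
  dom c (gamma t) -> dom d (gamma t) ->
  velocity_row d gamma t =
  velocity_row c gamma t *m jacobian_mx (transition c d) (position c gamma t).
Proof.
move=> Ac Ad It ct dt; apply/rowP => a.
have Ox : overlap c d (position c gamma t) by exists (gamma t).
have oO := @overlap_open c d.
have phis k := @transition_smooth c d k Ac Ad.
have H := curve_velocity_change oO phis Ox (geodesic_velocity Ac It ct) a.
have := near_eq_is_derive _ H.
move=> /(_ (fun s => position d gamma s 0 a)).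
move=> /(_ _)/@derive_val <-; last first.
  apply: filterS (geodesic_near_dom It ct) => s [_ cs].
  by rewrite /position /transition/= coordK.
by have [_ <-] := geodesic_velocity Ad It dt a.
Qed.

Lemma quadratic_value_chart c d t : A c -> A d -> I t ->
  dom c (gamma t) -> dom d (gamma t) ->
  quadratic_value (ricci g) c gamma t = quadratic_value (ricci g) d gamma t.
Proof.
move=> Ac Ad It ct dt.
have bil e : quadratic_value (ricci g) e gamma t =
    (velocity_row e gamma t *m ricci g e (position e gamma t)
      *m (velocity_row e gamma t)^T) 0 0.
  rewrite /quadratic_value exchange_big mxE; apply: eq_bigr => j _.
  rewrite mxE [X in _ * X]mxE [X in _ * X]mxE mulr_suml.
  by apply: eq_bigr => i _; rewrite [X in X * _ = _]mulrC [velocity_row e gamma t 0 i]mxE.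
have Ox : overlap c d (position c gamma t) by exists (gamma t).
rewrite !bil (velocity_row_change Ac Ad It ct dt) (ricci_change Ac Ad Ox).
have -> : position d gamma t = transition c d (position c gamma t).
  by rewrite /position /transition/= coordK.
by rewrite trmx_mul !mulmxA.
Qed.

Lemma derive_quadratic_value c t : A c -> I t -> dom c (gamma t) ->
  is_derive t 1 (quadratic_value (ricci g) c gamma)
    (\sum_m \sum_i \sum_j nabla_cov2 (g c) (ricci g c) m i j (position c gamma t)
      * velocity_row c gamma t 0 m * velocity_row c gamma t 0 i
      * velocity_row c gamma t 0 j).
Proof.
move=> Ac It ct.
have sR := smooth_ricci_loc (chart_img_open c) (spacetime_smooth Ac)
  (fun x => spacetime_sym Ac) (fun x => spacetime_unit Ac).
have cx : chart_img c (position c gamma t) by exists (gamma t).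
have := derive_quadratic_along_geodesic (chart_img_open c) sR cx
  (geodesic_velocity Ac It ct) (geodesic_acceleration Ac It ct).
congr (is_derive _ _ _ _); apply/funext => s.
by apply: eq_bigr => i _; apply: eq_bigr => j _; rewrite !mxE.
Qed.

End AlongGeodesic.
Lemma first_integral_of_cyclic :
  (forall c, A c -> forall x, chart_img c x -> forall i j k,
    nabla_cov2 (g c) (ricci g c) k i j x + nabla_cov2 (g c) (ricci g c) i j k x
    + nabla_cov2 (g c) (ricci g c) j k i x = 0) ->
  first_quadratic_integral A g (ricci g).
Proof.
move=> cyc I gamma oI itvI geo.
(* The chart chosen at each time may jump, but [Q] agrees near any t of [I] with the value in a
   fixed chart, which suffices to differentiate it. *)
have /choice[ch chP] t : exists c, A c /\ dom c (gamma t).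
  by have [c] := atlas_cover (manifold_atlas (spacetime_manifold stg)) (gamma t); exists c.
pose Q t := quadratic_value (ricci g) (ch t) gamma t.
have QE c t : A c -> I t -> dom c (gamma t) ->
    quadratic_value (ricci g) c gamma t = Q t.
  move=> Ac It ct; have [Ad dt] := chP t.
  exact: (quadratic_value_chart oI geo Ac Ad It ct dt).
have dQ t : I t -> is_derive t 1 Q 0.
  move=> It; have [Ac ct] := chP t.
  have := derive_quadratic_value geo Ac It ct; rewrite cubic_form_cyclic; last first.
    by apply: cyc => //; exists (gamma t).
  apply: near_eq_is_derive.
  by apply: filterS (geodesic_near_dom oI geo It ct) => s [Is cs]; exact: QE.
(* A constant must be exhibited even when [I] is empty. *)
have [[t0 It0]|noI] := pselect (exists t, I t); last first.
  by exists 0 => t It; case: noI; exists t.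
exists (Q t0) => t It c Ac ct; apply: etrans (QE c t Ac It ct) _.
exact: constant_on_interval itvI dQ t t0 It It0.
Qed.

Section LocalGeodesic.
Variables (c : chart R 4 M) (X U : R -> 'rV[R]_4) (e : R).
Hypotheses (Ac : A c) (cX : continuous X).
Hypothesis solX : forall t : R, `|t| < e -> [/\ chart_img c (X t),
  forall k, is_derive t 1 (fun s => X s 0 k) (U t 0 k) &
  forall k, is_derive t 1 (fun s => U s 0 k)
    (- \sum_i \sum_j christoffel (g c) k i j (X t) * U t 0 i * U t 0 j)].

Let I : set R := [set t | `|t| < e].
Let gamma t := param c (X t).

Lemma open_symmetric_interval : open I.
Proof.
have -> : I = ball (0 : R) e by apply/seteqP; split=> t; rewrite /I/= /ball/= sub0r normrN.
exact: ball_open.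
Qed.

Lemma is_interval_symmetric : is_interval I.
Proof.
move=> x y; rewrite /I/= !ltr_norml => /andP[x1 x2] /andP[y1 y2] z /andP[xz zy].
by rewrite /I/= ltr_norml (lt_le_trans x1 xz) (le_lt_trans zy y2).
Qed.

Lemma coord_local_geodesic t : I t -> Defs.coord c (gamma t) = X t.
Proof. by move=> /solX[[p cp Xp] _ _]; rewrite /gamma -Xp coordK. Qed.

Lemma dom_local_geodesic t : I t -> dom c (gamma t).
Proof. by move=> /solX[[p cp Xp] _ _]; rewrite /gamma -Xp coordK. Qed.

(** The curve solves the equation in [c] by construction; in any other chart [d] that it meets,
    position and velocity are transported by the transition map and its Jacobian. *)
Lemma local_geodesic : is_geodesic A g I gamma.
Proof.
split=> [t It|t It d Ad dt k].
  have [cx _ _] := solX It.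
  have cp : {for X t, continuous (param c)} := param_cts cx.
  exact: (cvg_comp _ _ (@cX t) cp).
have inO s : I s -> dom d (gamma s) -> overlap c d (X s).
  by move=> /solX[cx _ _]; exact: overlapP.
have oO := @overlap_open c d; have phis j := @transition_smooth c d j Ac Ad.
pose W s := U s *m jacobian_mx (transition c d) (X s).
have nO : \forall s \near t, I s /\ overlap c d (X s).
  have n1 := open_nbhs_nbhs (conj open_symmetric_interval It).
  have n2 : \forall s \near t, overlap c d (X s).
    by apply: (@cX t); exact: open_nbhs_nbhs (conj oO (inO t It dt)).
  by apply: filterS2 n1 n2.
have dY s a : I s -> overlap c d (X s) ->
    is_derive s 1 (coord_curve d gamma a) (W s 0 a).
  move=> /solX[_ dX _] Os; exact: (curve_velocity_change oO phis Os dX).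
(* Equality on a neighbourhood, not only at [t], is needed because the velocity is differentiated
   once more. *)
have vE a : \forall s \near t, W s 0 a = velocity d gamma a s.
  apply: filterS nO => s [Is Os].
  by rewrite /velocity derive1E; have [_ ->] := dY s a Is Os.
have vEt a : W t 0 a = velocity d gamma a t := nbhs_singleton (vE a).
have [cx dX dU] := solX It; have Ot := inO t It dt.
have dU' j : is_derive t 1 (fun s => U s 0 j)
    (- (U t *m \sum_i U t 0 i *: connection_mx (g c) i (X t)) 0 j).
  by rewrite -christoffel_quadratic; exact: dU.
have dW := @curve_acceleration_change R 4 (overlap c d) (chart_img c) (chart_img d)
  (transition c d) (g c) (g d) oO (chart_img_open c) (chart_img_open d)
  (@overlap_sub c d) (@overlap_transition c d) phis (spacetime_smooth Ad)
  (fun x => spacetime_sym Ac) (fun x => spacetime_sym Ad)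
  (fun x => spacetime_unit Ac) (fun x => spacetime_unit Ad)
  (fun x => metric_change Ac Ad) X U t Ot dX dU' k.
have dV := near_eq_is_derive (vE k) dW.
split; first by have [] := dY t k It Ot.
  by have [] := dV.
rewrite derive1E; have [_ ->] := dV.
rewrite -christoffel_quadratic addrC; apply/eqP; rewrite subr_eq0; apply/eqP.
apply: eq_bigr => i _; apply: eq_bigr => j _.
by rewrite -!vEt.
Qed.

Lemma velocity_local_geodesic t k : I t -> velocity c gamma k t = U t 0 k.
Proof.
move=> It; have [_ dX _] := solX It.
rewrite /velocity derive1E.
have [_ <-] := dX k; apply: near_eq_derive.
have n1 := open_nbhs_nbhs (conj open_symmetric_interval It).
by apply: filterS n1 => s Is; rewrite /coord_curve coord_local_geodesic.
Qed.

End LocalGeodesic.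

Lemma cyclic_of_first_integral : first_quadratic_integral A g (ricci g) ->
  forall c, A c -> forall x, chart_img c x -> forall i j k,
    nabla_cov2 (g c) (ricci g c) k i j x + nabla_cov2 (g c) (ricci g c) i j k x
    + nabla_cov2 (g c) (ricci g c) j k i x = 0.
Proof.
move=> fqi c Ac x cx.
have oD := chart_img_open c; have sm := spacetime_smooth Ac.
have sy y := @spacetime_sym c y Ac; have un y := @spacetime_unit c y Ac.
apply: (cubic_form_eq0 (P := fun m i j => nabla_cov2 (g c) (ricci g c) m i j x)).
  move=> m i j; rewrite !nabla_cov2E.
  by rewrite -{1}(covariant_ricci_sym oD sm sy un m cx) mxE.
move=> v.
have [X [U [e [X0 U0 e0 cX sol]]]] := quadratic_ode_local (x0 := x) (\row_i v i)
  oD cx (fun k i j => smooth_christoffel oD sm un k i j).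
have I0 : `|0 : R| < e by rewrite normr0.
have geo := local_geodesic Ac cX sol.
have oI := @open_symmetric_interval e.
have [C HC] := fqi _ _ oI (@is_interval_symmetric e) geo.
have ct := dom_local_geodesic sol I0.
have dQ := derive_quadratic_value geo Ac I0 ct.
have nC : \forall s \near (0 : R),
    quadratic_value (ricci g) c (fun t => param c (X t)) s = C.
  apply: filterS (open_nbhs_nbhs (conj oI I0)) => s Is.
  exact: (HC s Is c Ac (dom_local_geodesic sol Is)).
(* The derivative at 0 is computed twice: it is zero because the value is constant nearby, and it is
   the cubic form at the prescribed velocity [v]. *)
have := near_eq_is_derive nC dQ; have := is_derive_cst C (0 : R) (1 : R).
move=> /@derive_val d0 /@derive_val; rewrite d0 => /esym.
rewrite /position (coord_local_geodesic sol I0) X0.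
have vE k : velocity_row c (fun t => param c (X t)) 0 0 k = v k.
  by rewrite mxE (velocity_local_geodesic sol k I0) U0 mxE.
by under eq_bigr do under eq_bigr do under eq_bigr do rewrite !vE.
Qed.

End SpaceTimeGeometry.

Theorem theorem1 (R : realType) (M : topologicalType)
    (A : set (chart R 4 M)) (g : components2 R 4 M) :
  is_spacetime A g ->
  (class_Omega1 A g (energy_momentum g) <->
   first_quadratic_integral A g (ricci g)).
Proof.
move=> stg.
(* Both cyclic conditions are local, so they are compared chart by chart. *)
have loc c (Ac : A c) := Omega1_local_iff (@chart_img_open R M c) (spacetime_smooth stg Ac)
  (fun x => spacetime_sym stg Ac) (fun x => spacetime_unit stg Ac).
split=> [om|fqi].
- apply: (first_integral_of_cyclic stg) => c Ac.
  exact: ((loc c Ac).1 (om c Ac)).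
- move=> c Ac; apply/(loc c Ac).2; exact: (cyclic_of_first_integral stg fqi Ac).
Qed.
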